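(* Let $w\in W$ be straight and standard, and let $J=\operatorname{supp}(w)$. Then $$\operatorname{nub}(\widetilde w)\le\Bigl(\bigcap_{z\in\mathbb Z}\widetilde w^zV\widetilde w^{-z}\Bigr)\cap\operatorname{Fix}_H\bigl(R_{J^\perp\cup J^w_{\mathrm{sph}}}(c)\bigr)\cap\operatorname{Fix}_H\bigl(\Sigma\cap R_{J^{\mathrm{Cox}}_{\mathrm{aff}}}(c)\bigr).$$
   Context: Nub. For a totally disconnected locally compact (tdlc) group $H$ and $g\in H$, $\operatorname{con}(g)=\{h\in H: g^nhg^{-n}\to 1\text{ as }n\to\infty\}$ and $\operatorname{nub}(g)=\overline{\operatorname{con}(g)}\cap\overline{\operatorname{con}(g^{-1})}$. Coxeter notions. $(W,S)$ is a Coxeter system with $S$ finite and word length $\ell$. For $J\subseteq S$, $W_J=\langle J\rangle$; the components of $J$ are the vertex sets of the connected components of the Coxeter diagram of $(W_J,J)$. $J$ is spherical if $W_J$ is finite, and essential if it is nonempty and has no spherical component. An irreducible $J$ is affine if $W_J$ is infinite and virtually abelian, indefinite if neither spherical nor affine. $J^{\mathrm{Cox}}_{\mathrm{aff}}$ is the union of the affine components of $J$; $J^\perp=\{s\in S\setminus J:sj=js\ \forall j\in J\}$. Parabolic subgroups are the conjugates of the $W_J$ (the standard ones), spherical if finite; $\mathrm{Pc}(w)$ is the smallest parabolic subgroup containing $w$; $\operatorname{supp}(w)$ is the smallest $J\subseteq S$ with $w\in W_J$. $w\ne1$ is straight if $\ell(w^n)=n\ell(w)$ for all $n\in\mathbb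 N$; $w$ is cyclically reduced if $\ell(w)$ is minimal in its conjugacy class. If $(W,S)$ is irreducible indefinite and $\mathrm{Pc}(w)=W$, there is a largest spherical parabolic subgroup $P_w^{\max}$ normalized by $w$; $w$ is standard if it is cyclically reduced and $P_w^{\max}$ is standard. In general let $\mathrm{Pc}(w)=W_J$ with $J$ essential (for $w$ straight, $\mathrm{Pc}(w)=W_{\operatorname{supp}(w)}$ and $\operatorname{supp}(w)$ is essential), $J_1,\dots,J_k$ the indefinite components of $J$, $J_0=J^{\mathrm{Cox}}_{\mathrm{aff}}$, $w=w_0\cdots w_k$ with $w_i\in W_{J_i}$; $w$ is standard if each $w_i$, $i\ge1$, is standard in $(W_{J_i},J_i)$. Then $P_{w_i}^{\max}=W_{I_i}$, $I_i\subseteq J_i$, and $J^w_{\mathrm{sph}}:=I_1\cup\dots\cup I_k$. Roots. The simple roots are $\alpha_s=\{w\in W:\ell(sw)>\ell(w)\}$, and roots are the sets $v\alpha_s\subseteq W$ ($v\in W,s\in S$), forming $\Phi$; $-\alpha=W\setminus\alpha$; $\Phi_+$ (resp. $\Phi_-$) is the set of roots containing (resp. not containing) $1$. RGD systems. An RGD system $\mathcal D=(G,(U_\alpha)_{\alpha\in\Phi})$ of type $(W,S)$ is a group $G$ with subgroups $U_\alpha\neq\{1\}$ such that, with $T=\bigcap_\alpha N_G(U_\alpha)$ and $U_\pm=\langle U_\alpha:\alpha\in\Phi_\pm\rangle$: (i) for $\alpha\ne\beta$ with $\alpha\cap\beta\ne\varnothing\ne(-\alpha)\cap(-\beta)$,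 $[U_\alpha,U_\beta]\le\langle U_\gamma:\gamma\ne\alpha,\beta,\ \alpha\cap\beta\subseteq\gamma,\ (-\alpha)\cap(-\beta)\subseteq-\gamma\rangle$; (ii) for $s\in S$, $1\ne u\in U_{\alpha_s}$ there are $u',u''\in U_{-\alpha_s}$ such that $m(u)=u'uu''$ satisfies $m(u)U_\beta m(u)^{-1}=U_{s\beta}$ for all $\beta\in\Phi$; (iii) $U_{-\alpha_s}\not\le U_+$; (iv) $G=T\langle U_\alpha:\alpha\in\Phi\rangle$. Put $B=TU_+$ and $N=\langle T,m(u)\rangle$ (all such $u$); $(B,N)$ is a BN-pair with $N/T\cong W$. $\mathcal B$ is the associated building of type $(W,S)$: its chambers are the elements of $G/B$, with Weyl distance $\delta(gB,hB)=w\iff g^{-1}h\in BwB$. $c=B$ is the fundamental chamber, $\Sigma=\{wc:w\in W\}$ the fundamental apartment (identified with the Coxeter complex $W$ via $wc\leftrightarrow w$). $R_J(x)=\{y:\delta(x,y)\in W_J\}$ is the $J$-residue of $x$. $\mathrm{Aut}_0(\mathcal B)$ is the group of type-preserving ($\delta$-preserving) automorphisms, with the permutation topology (pointwise stabilizers of finite sets of chambers form a basis of identity neighbourhoods). Completions. Assume the root groups $U_\alpha$ are finite. A completion $H$ of $\mathcal D$ is a first-countable tdlc group with a continuous action $H\to\mathrm{Aut}_0(\mathcal B)$ and an injective homomorphism $G\to H$ compatible with the actions on $\mathcal B$ (so $G\le H$). $\operatorname{Fix}_H(X)$ is the pointwise stabilizer of $X\subseteq\mathcal B$ in $H$, and $H_d=\operatorname{Fix}_H(\{d\})$.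 A subgroup $V\le H$ is admissible if it is compact and open, $U_+\le V\le H_c$, $V$ is normalized by $T$, and $V=U_{\alpha_s}\ltimes(V\cap sVs^{-1})$ for all $s\in S$ (where $s$ in conjugations is any lift to $N$). Here $H$ is a completion of $\mathcal D$ whose chamber stabilizers $H_d$ are compact open, $V$ is an admissible subgroup of $H$, and $W\to N$, $w\mapsto\widetilde w$, is a fixed section of $N\to W$. Nubs are taken in $H$. *)

(* Defs.v *)
From HB Require Import structures.
From Stdlib Require Import Relations.
From mathcomp Require Import all_boot all_algebra.
From mathcomp Require Import all_classical topology.

Set Implicit Arguments.
Unset Strict Implicit.
Unset Printing Implicit Defensive.

Local Open Scope classical_set_scope.
Local Open Scope group_scope.

HB.mixin Record isTopologicalGroup H of Topological H & Group H := {
  mulg_continuous : continuous (fun xy : H * H => xy.1 * xy.2) ;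
  invg_continuous : continuous (fun x : H => x^-1)
}.

#[short(type="topologicalGroupType")]
HB.structure Definition TopologicalGroup :=
  {H of Topological H & Group H & isTopologicalGroup H}.

Section Order.
Context {T : Type}.
Implicit Types (C : set (set T)) (A : set T).

Definition is_least C A := C A /\ forall B, C B -> A `<=` B.
Definition is_greatest C A := C A /\ forall B, C B -> B `<=` A.

End Order.

Section Groups.
Context {G : groupType}.
Implicit Types (A B K : set G) (g : G).

Definition is_subgroup A :=
  [/\ A 1, (forall x y, A x -> A y -> A (x * y)) & (forall x, A x -> A x^-1)].

Definition gen A : set G := smallest is_subgroup A.

Definition conjs g A : set G := [set g * a * g^-1 | a in A].

Definition ltrans g A : set G := [set g * a | a in A].

Definition mulset A B : set G := [set a * b | a in A & b in B].

Definition commutator_subgroup A B : set G :=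
  gen [set [~ a, b] | a in A & b in B].

(* [A = B ⋉ K], an internal semidirect product with [K] the normal factor *)
Definition is_semidirect A B K :=
  [/\ is_subgroup B, is_subgroup K,
      A = mulset B K, B `&` K = [set 1]
    & forall a, A a -> conjs a K = K].

Definition virtually_abelian A :=
  exists K, [/\ is_subgroup K, K `<=` A,
    (forall x y, K x -> K y -> x * y = y * x)
  & exists2 F, finite_set F & A `<=` mulset F K].

Definition zpow g (z : int) : G :=
  match z with Posz n => g ^+ n | Negz n => g ^- n.+1 end.

End Groups.

Section Nub.
Context {H : topologicalGroupType}.

Definition con (g : H) : set H :=
  [set h | (fun n : nat => g ^+ n * h * g ^- n) @ \oo --> (1 : H)].

Definition nub (g : H) : set H := closure (con g) `&` closure (con g^-1).

Definition first_countable :=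
  forall x : H, exists B : nat -> set H,
    (forall n, nbhs x (B n)) /\
    (forall A, nbhs x A -> exists n, B n `<=` A).

Definition tdlc :=
  [/\ hausdorff_space H, totally_disconnected [set: H]
    & locally_compact [set: H]].

End Nub.
Arguments first_countable : clear implicits.
Arguments tdlc : clear implicits.

(* Generating sets are passed explicitly, and no definition of this section
   requires them to generate the whole of [W]: for [J] a subset of a Coxeter
   generating set, the notions taken at [J] are those of [(W_J, J)], where
   [W_J = gen J]. *)
Section Coxeter.
Context {W : groupType}.
Implicit Types (S J K I P : set W) (s t u v w : W).

(* [W] is presented by the generators [S] and the relations
   [(s t) ^ m(s,t) = 1], [m(s,t)] being the order of [s t]; the presentation is
   expressed by its universal property. *)
Definition coxeter_system S :=
  [/\ gen S = [set: W],
      (forall s, S s -> s <> 1 /\ s * s = 1)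
    & forall (L : groupType) (f : W -> L),
        (forall s t n, S s -> S t ->
           (s * t) ^+ n = 1 -> (f s * f t) ^+ n = 1) ->
        exists2 phi : W -> L, {morph phi : x y / x * y}
          & forall s, S s -> phi s = f s].

Definition has_word S w (n : nat) :=
  exists r : seq W,
    [/\ size r = n, (forall s, s \in r -> S s) & foldr *%g 1 r = w].

Definition wlength S w : nat :=
  get [set n | has_word S w n /\ forall m, has_word S w m -> (n <= m)%N].

(* [s] and [t] are joined in the Coxeter diagram iff [m(s,t) >= 3] *)
Definition coxeter_edge J s t := [/\ J s, J t & (s * t) ^+ 2 <> 1].

Definition linked J : relation W := clos_refl_trans W (coxeter_edge J).

Definition component J K :=
  exists2 s, J s & K = [set t | J t /\ linked J s t].

Definition irreducible J :=
  J !=set0 /\ forall s t, J s -> J t -> linked J s t.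

Definition spherical J := finite_set (gen J).

Definition essential J :=
  J !=set0 /\ forall K, component J K -> ~ spherical K.

Definition affine J :=
  [/\ irreducible J, infinite_set (gen J) & virtually_abelian (gen J)].

Definition indefinite J := [/\ irreducible J, ~ spherical J & ~ affine J].

Definition Jaff J : set W :=
  [set s | exists K, [/\ component J K, affine K & K s]].

Definition Jperp S J : set W :=
  [set s | [/\ S s, ~ J s & forall j, J j -> s * j = j * s]].

Definition parabolic S P :=
  exists v I, [/\ gen S v, I `<=` S & P = conjs v (gen I)].

Definition is_Pc S w P := is_least [set Q | parabolic S Q /\ Q w] P.

Definition is_supp S w J := is_least [set I | I `<=` S /\ gen I w] J.

Definition straight S w :=
  w <> 1 /\ forall n : nat, wlength S (w ^+ n) = (n * wlength S w)%N.

Definition cyclically_reduced S w :=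
  forall v, gen S v -> (wlength S w <= wlength S (v * w * v^-1))%N.

Definition is_Pmax S w P :=
  is_greatest
    [set Q | [/\ parabolic S Q, finite_set Q & conjs w Q = Q]] P.

Definition standard_indefinite S w :=
  cyclically_reduced S w /\ exists2 I, I `<=` S & is_Pmax S w (gen I).

(* [u] is the [W_K]-component of [w] in [W_J = W_K × W_(J \ K)], for [K] a
   component of [J] *)
Definition is_factor J K w u :=
  gen K u /\ exists2 v, gen (J `\` K) v & w = u * v.

Definition standard S w :=
  exists J, [/\ J `<=` S, essential J, is_Pc S w (gen J)
    & forall K u, component J K -> indefinite K -> is_factor J K w u ->
        standard_indefinite K u].

Definition Jsph J w : set W :=
  [set s | exists K u I, [/\ component J K, indefinite K, is_factor J K w u,
     I `<=` K /\ is_Pmax K u (gen I) & I s]].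

Definition simple_root S s : set W :=
  [set w | (wlength S w < wlength S (s * w))%N].

Definition coxeter_root S : set (set W) :=
  [set a | exists v s, S s /\ a = ltrans v (simple_root S s)].

End Coxeter.

(* Only the values of [U] at the roots matter; [~` a] is the root opposite
   to [a]. *)
Section RGD.
Context {W G : groupType}.
Variables (S : set W) (U : set W -> set G).

Definition torus : set G :=
  [set g | forall a, coxeter_root S a -> conjs g (U a) = U a].

Definition Uplus : set G :=
  gen (\bigcup_(a in [set a | coxeter_root S a /\ a 1]) U a).

(* [m] is an element [m(u)] for some nontrivial [u] in [U_(alpha_s)] with the
   property required in axiom (ii) of an RGD system *)
Definition m_of (s : W) (u m : G) :=
  exists u' u'', [/\ U (~` simple_root S s) u', U (~` simple_root S s) u'',
    m = u' * u * u''
  & forall b, coxeter_root S b -> conjs m (U b) = U (ltrans s b)].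

Definition rgd_interval (a b : set W) : set (set W) :=
  [set c | [/\ coxeter_root S c, c <> a /\ c <> b, a `&` b `<=` c
             & ~` a `&` ~` b `<=` ~` c]].

Definition rgd_system :=
  (forall a, coxeter_root S a -> is_subgroup (U a) /\ U a <> [set 1]) /\
  [/\ (forall a b, coxeter_root S a -> coxeter_root S b -> a <> b ->
         a `&` b !=set0 -> ~` a `&` ~` b !=set0 ->
         commutator_subgroup (U a) (U b) `<=`
           gen (\bigcup_(c in rgd_interval a b) U c)),
      (forall s u, S s -> U (simple_root S s) u -> u <> 1 ->
         exists m, m_of s u m),
      (forall s, S s -> ~ (U (~` simple_root S s) `<=` Uplus))
    & mulset torus (gen (\bigcup_(a in coxeter_root S) U a)) = [set: G]].

Definition borel : set G := mulset torus Uplus.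

(* the graph of the epimorphism [N -> N / T ≅ W], which is trivial on [T] and
   maps each [m(u)], [u] in [U_(alpha_s)], to [s] *)
Inductive NtoW : G -> W -> Prop :=
| NtoW_torus t : torus t -> NtoW t 1
| NtoW_m s u m : S s -> U (simple_root S s) u -> u <> 1 -> m_of s u m ->
    NtoW m s
| NtoW_mul n n' v v' : NtoW n v -> NtoW n' v' -> NtoW (n * n') (v * v')
| NtoW_inv n v : NtoW n v -> NtoW n^-1 v^-1.

Definition chamber := {C : set G | exists g, C = ltrans g borel}.

Definition coset_chamber (g : G) : chamber :=
  exist _ (ltrans g borel) (ex_intro _ g erefl).

Definition base_chamber : chamber := coset_chamber 1.

(* [weyl_dist x y w] stands for [delta(x, y) = w] *)
Definition weyl_dist (x y : chamber) (w : W) :=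
  exists g h n, [/\ x = coset_chamber g, y = coset_chamber h, NtoW n w
    & mulset borel (ltrans n borel) (g^-1 * h)].

Definition residue (J : set W) (x : chamber) : set chamber :=
  [set y | exists2 w, gen J w & weyl_dist x y w].

Definition apartment : set chamber :=
  [set x | exists n w, NtoW n w /\ x = coset_chamber n].

Section Completion.
Context {H : topologicalGroupType}.
Variables (iota : G -> H) (act : H -> chamber -> chamber).

Definition Fix (X : set chamber) : set H :=
  [set h | forall x, X x -> act h x = x].

(* A basis of neighbourhoods of [f] in the permutation topology is given by the
   sets of automorphisms agreeing with [f] on a given finite set of chambers:
   [action_continuous] is the continuity of [act : H -> Aut_0] at each [h]. *)
Definition action_continuous :=
  forall (h : H) (X : set chamber), finite_set X ->
    \forall k \near h, forall x, X x -> act k x = act h x.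

Definition type_preserving_action :=
  [/\ (forall x, act 1 x = x),
      (forall h k x, act (h * k) x = act h (act k x))
    & forall h x y w, weyl_dist (act h x) (act h y) w <-> weyl_dist x y w].

Definition completion :=
  [/\ tdlc H /\ first_countable H,
      type_preserving_action, action_continuous,
      injective iota /\ {morph iota : x y / x * y}
    & forall g k, act (iota g) (coset_chamber k) = coset_chamber (g * k)].

Definition admissible (V : set H) :=
  [/\ is_subgroup V /\ (compact V /\ open V),
      iota @` Uplus `<=` V, V `<=` Fix [set base_chamber],
      (forall t, torus t -> conjs (iota t) V = V)
    & forall s n, S s -> NtoW n s ->
        is_semidirect V (iota @` U (simple_root S s))
          (V `&` conjs (iota n) V)].

End Completion.
End RGD.

Arguments base_chamber {W G} S U.
Arguments apartment {W G} S U _.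

(* Main.v *)
From HB Require Import structures.
Require Import Defs.
From mathcomp Require Import all_boot all_algebra.
From mathcomp Require Import all_classical topology.
From mathcomp Require Import zify.

Local Open Scope classical_set_scope.
Local Open Scope group_scope.

(** The proof rests on one geometric criterion for an element [h] of the nub of
    a lift [g] of [w]. Suppose that a chamber [d] satisfies
    [delta (g ^- q d) d = a] for some [q > 0] and some [a] with
    [len (a ^+ k) = k * len a] for all [k]. Then the chambers [g ^+ (q * i) d]
    lie on a bi-infinite geodesic. As [h] is in the closure of [con g], it
    agrees at [d] with an element fixing [g ^- i d] for all large [i]; as it is
    in the closure of [con g^-1], it agrees at [d] with an element fixing
    [g ^+ i d] for all large [i]. So [h d] has the same Weyl distances as [d]
    from two points of the geodesic on both sides of [d]. A chamber between two
    others is determined by the type of a minimal gallery through it, so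
    [h d = d] ([nub_fixes_geodesic]). The criterion applies to three families of
    chambers.

    - The chamber [C 1], since [w] is straight. Moreover [h] is close to some [x]
      with [g ^+ i * x * g ^- i] in [V] for a large [i]. Both [x] and [h] fix
      [C 1], so this conjugate fixes [C (g ^+ i)]; splitting off root group
      elements along a reduced word of [w ^+ i], one finds [x], hence [h], in [V]
      ([admissible_conj], [nub_admissible]). The nub is normalised by [g], so it
      lies in every [g ^+ z * V * g ^- z].

    - The chambers [d] with [delta (C 1) d = v] in the subgroup generated by
      [Jperp S J] and [Jsph J w]. A straight element normalising a finite
      parabolic subgroup is shortest in its coset
      ([no_descent_normalized]), so a power [t] of [w] commutes with [v] and
      satisfies [len (t ^+ k * v) = len (t ^+ k) + len v] ([residue_power]).
      Then [t] permutes, by translation followed by projection to the residue,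
      the finite sphere of such chambers; a power of it fixes [d], and this is
      the criterion ([sphere_periodic]).

    - The chambers [v] of the standard apartment with [v] in [gen (Jaff J)]. The
      criterion asks that [v^-1 * w ^+ m * v] be straight for some [m > 0], that
      is, that the orbit [w ^+ (m * i) * v] never crosses a wall twice. This
      holds at [v = 1] and is preserved along galleries
      ([convex_orbit_step]): if [q] is the reflection in the next wall, a power
      [t] of [w] commutes with [q * t * q] because affine Coxeter groups are
      virtually abelian, and then either a power of [t] fixes both sides of the
      wall of [q], or the orbit crosses this wall next to the place where it is
      being moved ([reflection_translation]).

    Two classical theories are developed on the way. For Coxeter groups, the
    universal property yields the cocycle counting the walls that separate two
    chambers, from which the exchange condition and all facts on lengths follow.
    For root group data, the decomposition of [U_+] relative to a simple root
    ([Uplus_split]) gives the multiplication rules of Bruhat cells, hence the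
    properties of the Weyl distance. *)

Set Implicit Arguments.
Unset Strict Implicit.
Unset Printing Implicit Defensive.

(** * Subgroups, conjugation and translation *)

(** Rewrites to a freely reduced word, bracketed to the left. *)
Ltac gsimp :=
  rewrite ?(invgM, invgK, invg1, mulgA, mulgK, mulgVK, mulVg, mulgV, mul1g, mulg1).

Section Subgroups.
Context {G : groupType}.
Implicit Types (A B K : set G) (g x y : G).

Lemma gen_subgroup A : is_subgroup (gen A).
Proof.
split; first by move=> K [[]].
- move=> x y Ax Ay K KA; have [_ KM _] := KA.1.
  by apply: KM; [apply: Ax | apply: Ay].
- by move=> x Ax K KA; have [_ _ KV] := KA.1; apply: KV; apply: Ax.
Qed.

Lemma sub_gen A : A `<=` gen A.
Proof. by move=> x Ax K [_ AK]; apply: AK. Qed.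

Lemma gen_min A K : is_subgroup K -> A `<=` K -> gen A `<=` K.
Proof. by move=> Ksub AK x; apply. Qed.

Lemma genS A B : A `<=` B -> gen A `<=` gen B.
Proof. by move=> AB; apply: gen_min (gen_subgroup B) _ => x /AB/sub_gen. Qed.

Lemma gen1 A : gen A 1. Proof. by have [] := gen_subgroup A. Qed.

Lemma genM A x y : gen A x -> gen A y -> gen A (x * y).
Proof. by have [_ AM _] := gen_subgroup A; apply: AM. Qed.

Lemma genV A x : gen A x -> gen A x^-1.
Proof. by have [_ _ AV] := gen_subgroup A; apply: AV. Qed.

Lemma genX A x n : gen A x -> gen A (x ^+ n).
Proof.
move=> Ax; elim: n => [|n IHn]; first exact: gen1.
by rewrite expgS; apply: genM.
Qed.

Lemma conjsP g A x : conjs g A x <-> A (g^-1 * x * g).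
Proof.
split=> [[a Aa <-]|Ax]; first by gsimp.
by exists (g^-1 * x * g) => //; gsimp.
Qed.

Lemma ltransP g A x : ltrans g A x <-> A (g^-1 * x).
Proof.
split=> [[a Aa <-]|Ax]; first by gsimp.
by exists (g^-1 * x) => //; gsimp.
Qed.

Lemma subgroup_conjs K g : is_subgroup K -> is_subgroup (conjs g K).
Proof.
move=> [K1 KM KV]; split=> [|x y /conjsP Kx /conjsP Ky|x /conjsP Kx].
- by apply/conjsP; gsimp.
- by apply/conjsP; move: (KM _ _ Kx Ky); gsimp.
- by apply/conjsP; move: (KV _ Kx); gsimp.
Qed.

Lemma conjsM g x A : conjs (g * x) A = conjs g (conjs x A).
Proof.
apply/seteqP; split=> y /conjsP h.
  by do 2 apply/conjsP; move: h; gsimp.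
by apply/conjsP; move/conjsP: h; gsimp.
Qed.

Lemma conjs1 A : conjs 1 A = A.
Proof. by apply/seteqP; split=> x; rewrite -[A x]/(A x) conjsP; gsimp. Qed.

Lemma ltransM g x A : ltrans (g * x) A = ltrans g (ltrans x A).
Proof.
apply/seteqP; split=> y /ltransP h.
  by do 2 apply/ltransP; move: h; gsimp.
by apply/ltransP; move/ltransP: h; gsimp.
Qed.

Lemma ltrans1 A : ltrans 1 A = A.
Proof. by apply/seteqP; split=> x; rewrite ltransP; gsimp. Qed.

Lemma eq_conjg a x y : (a^-1 * x * a == y) = (x == a * y * a^-1).
Proof. by apply/eqP/eqP=> [<-|->]; gsimp. Qed.

Lemma centralizer_subgroup x : is_subgroup [set y | commute x y].
Proof.
split=> [|y z|y]; [exact: commute1|exact: commuteM|exact: commuteV].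
Qed.

(** A subgroup, since [x ^+ (p * q)] commutes with [v * v'] when [x ^+ p]
    commutes with [v] and [x ^+ q] with [v']. *)
Lemma power_centralizer_subgroup x :
  is_subgroup [set v | exists2 p, (0 < p)%N & commute (x ^+ p) v].
Proof.
split=> [|u v [p p0 cu] [q q0 cv]|v [p p0 cv]].
- by exists 1%N => //; apply: commute1.
- exists (p * q)%N; first by rewrite muln_gt0 p0.
  apply: commuteM; first rewrite expgnA; last rewrite mulnC expgnA.
    by apply/commute_sym/commuteX/commute_sym.
  by apply/commute_sym/commuteX/commute_sym.
- by exists p => //; apply: commuteV.
Qed.

End Subgroups.

(** * The inversion cocycle of a Coxeter group *)

(** The semidirect product of [W] with the sets of elements of [W] under
    symmetric difference, on which [W] acts by conjugation. A morphism from [W]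
    to it that lifts the identity is a cocycle: a rule attaching to [x] a set
    [N x] with [N (x * y) = N x + x * N y * x^-1]. Sending each generator [s] to
    [({s}, s)] will attach to [x] the set of reflections whose walls separate
    [1] from [x]. *)
Definition twisted (W : groupType) := ((W -> bool) * W)%type.

Section Twisted.
Context {W : groupType}.
Implicit Types a b : twisted W.

Definition twisted_mul a b : twisted W :=
  (fun r => a.1 r (+) b.1 (a.2^-1 * r * a.2), a.2 * b.2).
Definition twisted_one : twisted W := (fun=> false, 1).
Definition twisted_inv a : twisted W :=
  (fun r => a.1 (a.2 * r * a.2^-1), a.2^-1).

Lemma twisted_mulA : associative twisted_mul.
Proof.
move=> [a x] [b y] [c z]; rewrite /twisted_mul /=; gsimp.
by congr pair; apply/funext=> r; rewrite addbA; gsimp.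
Qed.

Lemma twisted_mul1 : left_id twisted_one twisted_mul.
Proof.
move=> [a x]; rewrite /twisted_mul /=; gsimp.
by congr pair; apply/funext=> r; gsimp.
Qed.

Lemma twisted_mulr1 : right_id twisted_one twisted_mul.
Proof.
move=> [a x]; rewrite /twisted_mul /=; gsimp.
by congr pair; apply/funext=> r; rewrite addbF.
Qed.

Lemma twisted_mulV : left_inverse twisted_one twisted_inv twisted_mul.
Proof.
move=> [a x]; rewrite /twisted_mul /=; gsimp.
by congr pair; apply/funext=> r; gsimp; rewrite addbb.
Qed.

Lemma twisted_mulrV : right_inverse twisted_one twisted_inv twisted_mul.
Proof.
move=> [a x]; rewrite /twisted_mul /=; gsimp.
by congr pair; apply/funext=> r; gsimp; rewrite addbb.
Qed.

HB.instance Definition _ := gen_eqMixin (twisted W).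
HB.instance Definition _ := gen_choiceMixin (twisted W).
HB.instance Definition _ := isGroup.Build (twisted W) twisted_mulA
  twisted_mul1 twisted_mulr1 twisted_mulV twisted_mulrV.

Lemma twisted_snd_expg a n : (a ^+ n).2 = a.2 ^+ n.
Proof. by elim: n => [//|m IHm]; rewrite !expgS -IHm. Qed.

Lemma twisted_expg a n r :
  (a ^+ n).1 r = \big[addb/false]_(0 <= k < n) a.1 (a.2 ^- k * r * a.2 ^+ k).
Proof.
elim: n r => [|n IHn] r; first by rewrite big_nil.
by rewrite expgSr big_nat_recr //= -IHn twisted_snd_expg.
Qed.

End Twisted.

Definition is_reflection {W : groupType} (S : set W) (r : W) :=
  exists v s, S s /\ r = v * s * v^-1.

Section Cocycle.
Context {W : groupType} {S : set W} (cox : coxeter_system S).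

Lemma gens_sq s : S s -> s * s = 1.
Proof. by have [_ invS _] := cox => /invS[]. Qed.

Lemma gens_inv s : S s -> s^-1 = s.
Proof. by move/gens_sq/mulg1_eq. Qed.

Lemma dihedral_swap (s t : W) k : S s -> S t ->
  s * (s * t) ^- k = (s * t) ^+ k * s.
Proof.
move=> Ss St; elim: k => [|k IHk]; first by rewrite expg0; gsimp.
rewrite expgS invgM mulgA IHk -mulgA invgM !gens_inv // mulgA -expgS expgSr.
by gsimp.
Qed.

(** The relations hold in the twisted product: the set attached to
    [(s * t) ^+ n] is the sum of the reflections [(s * t) ^+ j * s] for
    [j < 2 * n], and when [(s * t) ^+ n = 1] each of them occurs twice. *)
Lemma inversion_exists : exists inv : W -> W -> bool,
  (forall r x y, inv r (x * y) = inv r x (+) inv (x^-1 * r * x) y) /\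
  (forall s r, S s -> inv r s = (r == s)).
Proof.
have [genS _ univ] := cox.
pose f (s : W) : twisted W := (fun r => r == s, s).
have [s t n Ss St stn|phi phiM phif] := univ _ f.
  have e2 : (f s * f t).2 = s * t by [].
  apply: injective_projections; last by rewrite twisted_snd_expg e2.
  apply/funext => r; rewrite twisted_expg e2 -[(1 : twisted W).1 r]/false.
  pose g j := r == (s * t) ^+ j * s.
  have -> : \big[addb/false]_(0 <= k < n)
      (f s * f t).1 ((s * t) ^- k * r * (s * t) ^+ k) =
      \big[addb/false]_(0 <= j < n.*2) g j.
    elim: n {stn} => [|n IHn]; first by rewrite !big_nil.
    rewrite doubleS !big_nat_recr //= IHn -addbA; congr (_ (+) _).
    congr (_ (+) _); rewrite /g.
      rewrite -addnn expgnDr -(mulgA _ _ s) -(dihedral_swap n Ss St) mulgA.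
      by rewrite eq_conjg.
    have -> : (s * t) ^+ n.*2.+1 * s = (s * t) ^+ n * (s * t * s) * (s * t) ^- n.
      rewrite -!mulgA (dihedral_swap n Ss St) -addnn -addnS expgnDr expgS.
      by gsimp.
    by rewrite eq_conjg eq_conjg gens_inv.
  rewrite -addnn (@big_cat_nat _ _ _ n) ?leq_addr //=.
  rewrite -{2}[n]add0n big_addn addnK.
  under [X in _ (+) X]eq_bigr => j _ do rewrite /g addnC expgnDr stn mul1g.
  by rewrite addbb.
have phi1 : phi 1 = 1 by apply: (mulgI (phi 1)); rewrite -phiM !mulg1.
have phi2 x : (phi x).2 = x.
  have genSx : gen S x by rewrite genS.
  apply: (@gen_min _ S [set x | (phi x).2 = x]) genSx; last first.
    by move=> s Ss /=; rewrite phif.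
  split=> [|y z /= ey ez|y /= ey]; first by rewrite /= phi1.
    by rewrite phiM -{2}ey -{2}ez.
  have /mulg1_eq <- : phi y * phi y^-1 = 1 by rewrite -phiM mulgV.
  by rewrite -{2}ey.
exists (fun r x => (phi x).1 r); split=> [r x y|s r Ss]; last by rewrite phif.
by rewrite phiM -{3 4}(phi2 x).
Qed.

(** The wall of [r] separates the chambers [1] and [x]. *)
Definition inversion : W -> W -> bool := projT1 (cid inversion_exists).

Lemma inversionM r x y :
  inversion r (x * y) = inversion r x (+) inversion (x^-1 * r * x) y.
Proof. exact: (projT2 (cid inversion_exists)).1. Qed.

Lemma inversion_gen s r : S s -> inversion r s = (r == s).
Proof. exact: (projT2 (cid inversion_exists)).2. Qed.

Lemma inversion1 r : inversion r 1 = false.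
Proof.
by have := inversionM r 1 1; rewrite mulg1; gsimp; case: (inversion r 1).
Qed.

Lemma inversionV r x : inversion r x^-1 = inversion (x * r * x^-1) x.
Proof.
have := inversionM (x * r * x^-1) x x^-1; rewrite mulgV inversion1; gsimp.
by case: inversion; case: inversion.
Qed.

Definition word (K : set W) (l : seq W) := forall s, s \in l -> K s.

Definition wprod (l : seq W) : W := foldr *%g 1 l.

(** The walls crossed by the gallery from [1] of type [l]. *)
Fixpoint reflections (l : seq W) : seq W :=
  if l is s :: l' then s :: [seq s * r * s^-1 | r <- reflections l'] else [::].

Lemma size_reflections l : size (reflections l) = size l.
Proof. by elim: l => //= s l IHl; rewrite size_map IHl. Qed.

Lemma word_cons (K : set W) s l : word K (s :: l) <-> K s /\ word K l.
Proof.
split=> [Kl|[Ks Kl] t]; last by rewrite inE => /predU1P[->|/Kl].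
by split=> [|t tl]; apply: Kl; rewrite inE ?eqxx ?tl ?orbT.
Qed.

Lemma word_cat (K : set W) l1 l2 : word K (l1 ++ l2) <-> word K l1 /\ word K l2.
Proof.
split=> [Kl|[K1 K2] t]; last by rewrite mem_cat => /orP[/K1|/K2].
by split=> t tl; apply: Kl; rewrite mem_cat tl ?orbT.
Qed.

Lemma word_subseq (K : set W) l l' : subseq l' l -> word K l -> word K l'.
Proof. by move=> /mem_subseq ll' Kl s /ll'/Kl. Qed.

Lemma wprod_cat l1 l2 : wprod (l1 ++ l2) = wprod l1 * wprod l2.
Proof. by elim: l1 => [|s l1 IHl]; rewrite ?mul1g //= IHl mulgA. Qed.

Lemma wprod_rev l : word S l -> wprod (rev l) = (wprod l)^-1.
Proof.
elim: l => [|s l IHl]; first by rewrite invg1.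
move=> /word_cons[Ss /IHl e]; rewrite rev_cons -cats1 wprod_cat e /= mulg1.
by rewrite invgM (gens_inv Ss).
Qed.

Lemma gen_word (K : set W) x : K `<=` S -> gen K x ->
  exists2 l, word K l & wprod l = x.
Proof.
move=> KS Kx; apply: (@gen_min _ K [set x | exists2 l, word K l & wprod l = x])
  Kx; last first.
  move=> s Ks; exists [:: s]; last by rewrite /= mulg1.
  by apply/word_cons.
split=> [|y z [l1 Kl1 <-] [l2 Kl2 <-]|y [l Kl <-]]; first by exists [::].
- by exists (l1 ++ l2); rewrite ?wprod_cat // word_cat.
- exists (rev l); first by move=> s; rewrite mem_rev => /Kl.
  by apply: wprod_rev => s /Kl/KS.
Qed.

Lemma word_gen (K : set W) l : word K l -> gen K (wprod l).
Proof.
elim: l => [|s l IHl]; first by move=> _; apply: gen1.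
by move=> /word_cons[/sub_gen Ks /IHl]; apply: genM.
Qed.

Lemma inversion_word l r : word S l ->
  inversion r (wprod l) = odd (count_mem r (reflections l)).
Proof.
elim: l r => [|s l IHl] r; first by rewrite inversion1.
move=> /word_cons[Ss Sl] /=; rewrite inversionM inversion_gen // IHl // oddD.
rewrite eq_sym oddb; congr (_ (+) odd _); rewrite count_map.
by apply: eq_count => t /=; rewrite eq_sym eq_conjg eq_sym.
Qed.

Lemma inversion_reduced l r : word S l -> uniq (reflections l) ->
  inversion r (wprod l) = (r \in reflections l).
Proof.
by move=> Sl Ul; rewrite inversion_word // count_uniq_mem //; case: (_ \in _).
Qed.

Lemma exchange l r : word S l -> r \in reflections l -> exists l',
  [/\ subseq l' l, (size l').+1 = size l & wprod l' = r * wprod l].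
Proof.
elim: l r => [//|s l IHl] r /word_cons[Ss Sl] /=; rewrite inE.
have [-> _|_ /= /mapP[t tl ->]] := eqVneq r s.
  exists l; split=> //; first exact: (subseq_cons l s).
  by rewrite mulgA gens_sq // mul1g.
have [l' [sub sz e]] := IHl t Sl tl.
by exists (s :: l'); rewrite /= eqxx sz e; gsimp.
Qed.

Lemma deletion l : word S l -> ~~ uniq (reflections l) -> exists l',
  [/\ subseq l' l, (size l' < size l)%N & wprod l' = wprod l].
Proof.
elim: l => [//|s l IHl] /word_cons[Ss Sl] /=; rewrite negb_and negbK.
have injs : injective (fun r => s * r * s^-1).
  by move=> x y /mulIg/mulgI.
rewrite map_inj_uniq // => /orP[/mapP[r rl e]|/(IHl Sl)[l' [sub sz e]]].
  have {}e : r = s.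
    by rewrite -[r](mulKg s) -[s * r](mulgK s^-1) invgK -e; gsimp.
  have [l' [sub sz e']] := exchange Sl rl.
  exists l'; rewrite e' e; split=> //.
  - exact: subseq_trans (subseq_cons _ _).
  - by rewrite -sz ltnW.
by exists (s :: l'); rewrite /= eqxx e.
Qed.

Lemma reduced_subword l : word S l -> exists l',
  [/\ subseq l' l, uniq (reflections l') & wprod l' = wprod l].
Proof.
have [n] := ubnP (size l); elim: n l => // n IHn l ln Sl.
case: (boolP (uniq (reflections l))) => [Ul|/(deletion Sl)[l1 [s1 z1 <-]]].
  by exists l.
have [l2 [s2 U2 <-]] := IHn l1 (leq_trans z1 ln) (word_subseq s1 Sl).
by exists l2; split=> //; apply: subseq_trans s1.
Qed.

Lemma reduced_word (K : set W) x : K `<=` S -> gen K x ->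
  exists l, [/\ word K l, uniq (reflections l) & wprod l = x].
Proof.
move=> KS /(gen_word KS)[l Kl <-].
have [|l' [sub U e]] := @reduced_subword l; first by move=> s /Kl/KS.
by exists l'; split=> //; apply: word_subseq sub Kl.
Qed.

Local Notation len := (wlength S).

(** If a gallery crosses no wall twice, the walls that it crosses are those
    separating its ends, and every gallery with the same ends crosses them. *)
Lemma wlength_reduced l : word S l -> uniq (reflections l) ->
  len (wprod l) = size l.
Proof.
move=> Sl Ul; pose P := fun n => `[< has_word S (wprod l) n >].
have exP : exists n, P n by exists (size l); apply/asboolP; exists l.
have [|[l' [z' Sl' e']] minl] := @getPex _ [set n | has_word S (wprod l) n /\
    forall m, has_word S (wprod l) m -> (n <= m)%N].
  case: (ex_minnP exP) => m /asboolP Pm minm; exists m; split=> // k kl.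
  by apply: minm; apply/asboolP.
rewrite -/(wlength S _) in z' minl *.
have Ul' : uniq (reflections l').
  apply/negPn/negP => /(deletion Sl')[l2 [s2 sz2 e2]].
  have /minl : has_word S (wprod l) (size l2).
    by exists l2; split; rewrite -?e' //; apply: word_subseq s2 Sl'.
  by rewrite -z' leqNgt sz2.
rewrite -z' -(size_reflections l) -(size_reflections l').
apply: perm_size; apply: uniq_perm => // r.
by rewrite -!inversion_reduced // -e'.
Qed.

Lemma reducedP x : exists l, [/\ word S l, uniq (reflections l), wprod l = x
  & size l = len x].
Proof.
have [|l [Sl Ul <-]] := @reduced_word S x (fun=> id).
  by have [-> ] := cox.
by exists l; split=> //; rewrite wlength_reduced.
Qed.

Lemma wlength1 : len 1 = 0%N.
Proof. by rewrite -[1]/(wprod [::]) wlength_reduced. Qed.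

Lemma wlength_eq0 x : len x = 0%N -> x = 1.
Proof. by have [l [_ _ <- <-]] := reducedP x => /size0nil->. Qed.

Lemma leq_wlength_word l : word S l -> (len (wprod l) <= size l)%N.
Proof.
move=> Sl; have [l' [sub U <-]] := reduced_subword Sl.
by rewrite wlength_reduced ?(size_subseq sub) //; apply: word_subseq Sl.
Qed.

Lemma wlengthV x : len x^-1 = len x.
Proof.
have leV y : (len y^-1 <= len y)%N.
  have [l [Sl Ul <- <-]] := reducedP y.
  rewrite -(wprod_rev Sl) -(size_rev l) leq_wlength_word // => s.
  by rewrite mem_rev => /Sl.
by apply/eqP; rewrite eqn_leq leV -{1}[x]invgK leV.
Qed.

Lemma leq_wlengthM x y : (len (x * y) <= len x + len y)%N.
Proof.
have [l1 [Sl1 _ <- <-]] := reducedP x; have [l2 [Sl2 _ <- <-]] := reducedP y.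
by rewrite -wprod_cat -size_cat leq_wlength_word //; apply/word_cat.
Qed.

Lemma reflections_cat l1 l2 : reflections (l1 ++ l2) =
  reflections l1 ++ [seq wprod l1 * r * (wprod l1)^-1 | r <- reflections l2].
Proof.
elim: l1 => [|s l1 IHl] /=.
  by rewrite -[LHS]map_id; apply: eq_map => r; gsimp.
congr cons; rewrite IHl map_cat -map_comp; congr cat.
by apply: eq_map => r /=; gsimp.
Qed.

(** A gallery from [x^-1] to [y] through [1], minimal on both sides of [1], is
    minimal when it crosses no wall twice. *)
Lemma wlengthM_additive x y : len (x * y) = (len x + len y)%N <->
  forall r, inversion r x^-1 -> inversion r y = false.
Proof.
have [l1 [Sl1 U1 <- <-]] := reducedP x; have [l2 [Sl2 U2 <- <-]] := reducedP y.
have Sl : word S (l1 ++ l2) by apply/word_cat.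
rewrite -wprod_cat -size_cat.
pose c r := wprod l1 * r * (wprod l1)^-1.
have injc : injective c by move=> r t /mulIg/mulgI.
split=> [e r|dis]; last first.
  rewrite wlength_reduced // reflections_cat cat_uniq U1 map_inj_uniq // U2 andbT.
  apply/hasPn => _ /mapP[r r2 ->]; apply/negP => r1.
  by have := dis r; rewrite inversionV !inversion_reduced // => /(_ r1); rewrite r2.
have : uniq (reflections (l1 ++ l2)).
  apply/negPn/negP => /(deletion Sl)[l' [sub sz e']]; move: sz.
  by rewrite -e -e' ltnNge leq_wlength_word //; apply: word_subseq Sl.
rewrite reflections_cat cat_uniq => /and3P[_ /hasPn dis _].
rewrite inversionV !inversion_reduced // => r1; apply/negP => r2.
by have := dis (c r); rewrite map_f //= /c r1 => /(_ isT).
Qed.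

Lemma reflection_sq r : is_reflection S r -> r * r = 1.
Proof. by move=> [v [s [Ss ->]]]; gsimp; rewrite -(mulgA v) gens_sq //; gsimp. Qed.

Lemma reflection_inv r : is_reflection S r -> r^-1 = r.
Proof. by move/reflection_sq/mulg1_eq. Qed.

(** In [v * s * v^-1], the contributions of [v] and of [v^-1] cancel. *)
Lemma inversion_self r : is_reflection S r -> inversion r r.
Proof.
move=> [v [s [Ss ->]]]; rewrite !inversionM inversionV (inversion_gen _ Ss).
by gsimp; rewrite eqxx; case: inversion.
Qed.

Lemma inversion_mull r x : is_reflection S r ->
  inversion r (r * x) = ~~ inversion r x.
Proof.
by move=> rr; rewrite inversionM inversion_self //; gsimp.
Qed.

Lemma inversion_wlength r x : is_reflection S r ->
  inversion r x = (len (r * x) < len x)%N.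
Proof.
have lt y : inversion r y -> (len (r * y) < len y)%N.
  have [l [Sl Ul <- <-]] := reducedP y; rewrite inversion_reduced // => rl.
  have [l' [sub <- <-]] := exchange Sl rl.
  by rewrite ltnS leq_wlength_word //; apply: word_subseq Sl.
move=> rr; apply/idP/idP => [/lt//|]; apply: contraTT.
rewrite -inversion_mull // => /lt; rewrite mulgA reflection_sq // mul1g => /ltnW.
by rewrite -leqNgt.
Qed.

End Cocycle.

(** * Half-spaces and roots *)
Section HalfSpaces.
Context {W : groupType} {S : set W} (cox : coxeter_system S).
Local Notation len := (wlength S).
Local Notation inv := (inversion cox).
Local Notation refl := (is_reflection S).

Lemma gens_reflection s : S s -> refl s.
Proof. by move=> Ss; exists 1, s; split=> //; gsimp. Qed.

(** The chambers on one side of the wall of [q]: the side of [1] if [e] is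
    [false], the opposite one otherwise. *)
Definition halfspace q e : set W := [set x | inv q x = e].

Lemma halfspaceC q e : ~` halfspace q e = halfspace q (~~ e).
Proof.
by apply/seteqP; rewrite /halfspace; split=> x /=; case: (inv q x); case: e.
Qed.

Lemma simple_rootE s : S s -> simple_root S s = halfspace s false.
Proof.
move=> Ss; have rs := gens_reflection Ss.
apply/seteqP; split=> x /=.
  move=> h; rewrite /halfspace /= inversion_wlength //.
  by apply/negbTE; rewrite -leqNgt ltnW.
rewrite /halfspace /= => h; have : inv s (s * x) by rewrite inversion_mull // h.
by rewrite inversion_wlength // mulgA (gens_sq cox Ss) mul1g.
Qed.

Lemma ltrans_halfspace v q e : ltrans v (halfspace q e) =
  halfspace (v * q * v^-1) (e (+) inv (v * q * v^-1) v).
Proof.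
apply/seteqP; split=> x; rewrite ltransP /halfspace /= inversionM inversionV; gsimp.
  by move=> <-; case: inversion; case: inversion.
by move=> ->; case: inversion; case: e.
Qed.

Lemma inversion_cross q x s : S s ->
  inv q (x * s) = inv q x (+) (q == x * s * x^-1).
Proof. by move=> Ss; rewrite inversionM (inversion_gen _ _ Ss) eq_conjg. Qed.

Lemma coxeter_rootP a :
  coxeter_root S a <-> exists q e, refl q /\ a = halfspace q e.
Proof.
split=> [[v [s [Ss ->]]]|[q [e [[v [s [Ss ->]]] ->]]]].
  rewrite simple_rootE // ltrans_halfspace; do 2 eexists; split=> //.
  by exists v, s.
have [e1|e1] := eqVneq e (inv (v * s / v) v).
  by exists v, s; split=> //; rewrite simple_rootE // ltrans_halfspace -e1.
exists (v * s), s; split=> //; rewrite simple_rootE // ltrans_halfspace.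
have -> : v * s * s / (v * s) = v * s / v by gsimp.
rewrite inversion_cross // eqxx; congr halfspace.
by case: e e1; case: inv.
Qed.

Lemma root_simple s : S s -> coxeter_root S (simple_root S s).
Proof. by move=> Ss; exists 1, s; rewrite ltrans1. Qed.

Lemma coxeter_root_ltrans v a : coxeter_root S a -> coxeter_root S (ltrans v a).
Proof. by move=> [x [s [Ss ->]]]; exists (v * x), s; rewrite ltransM. Qed.

Lemma coxeter_rootC a : coxeter_root S a -> coxeter_root S (~` a).
Proof.
move=> /coxeter_rootP[q [e [qq ->]]]; apply/coxeter_rootP.
by exists q, (~~ e); rewrite halfspaceC.
Qed.

Lemma ltransC v (a : set W) : ltrans v (~` a) = ~` ltrans v a.
Proof. by apply/seteqP; split=> x /=; rewrite !ltransP. Qed.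

Lemma ltrans_simple s : S s -> ltrans s (simple_root S s) = ~` simple_root S s.
Proof.
move=> Ss; rewrite simple_rootE // ltrans_halfspace mulgK halfspaceC.
by rewrite inversion_gen // eqxx.
Qed.

Lemma simple_root1 s : S s -> simple_root S s 1.
Proof. by move=> Ss; rewrite simple_rootE // /halfspace /= inversion1. Qed.

Lemma simple_root_self s : S s -> ~ simple_root S s s.
Proof. by move=> Ss; rewrite simple_rootE // /halfspace /= inversion_gen // eqxx. Qed.

(** Only the wall of [s] separates [1] from [s]. *)
Lemma root_separating s a : S s -> coxeter_root S a -> a 1 -> ~ a s ->
  a = simple_root S s.
Proof.
move=> Ss /coxeter_rootP[q [e [qq ->]]]; rewrite /halfspace /= inversion1.
by move=> <-; rewrite inversion_gen //; case: eqP => // -> _; rewrite simple_rootE.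
Qed.

Lemma root_pos_gen s a : S s -> coxeter_root S a -> a 1 ->
  a <> simple_root S s -> a s.
Proof. by move=> Ss ra a1 ne; apply: contrapT => /(root_separating Ss ra a1). Qed.

Lemma root_neq0 a : coxeter_root S a -> a !=set0.
Proof.
move=> [v [s [Ss ->]]]; exists v; apply/ltransP; rewrite mulVg.
exact: simple_root1.
Qed.

Lemma simple_root_wlength s x : S s ->
  (len x < len (x * s))%N -> ltrans x (simple_root S s) 1.
Proof.
move=> Ss; rewrite -(wlengthV cox x) -(wlengthV cox (x * s)) invgM (gens_inv cox Ss).
by move=> h; apply/ltransP; rewrite mulg1.
Qed.

End HalfSpaces.

(** * Straight elements and the walls crossed by their orbits *)

Section Additive.
Context {W : groupType} {S : set W} (cox : coxeter_system S).
Implicit Types (t x y q r s v : W).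
Local Notation len := (wlength S).
Local Notation inv := (inversion cox).

(** Straightness without the condition [x <> 1], so as to pass to all powers. *)
Definition additive_powers x :=
  forall m n, len (x ^+ (m + n)) = (len (x ^+ m) + len (x ^+ n))%N.

Lemma additive_powersX x k : additive_powers x -> additive_powers (x ^+ k).
Proof. by move=> xadd m n; rewrite -!expgnA mulnDr xadd. Qed.

Lemma straight_additive x : straight S x -> additive_powers x.
Proof. by move=> [_ sx] m n; rewrite !sx mulnDl. Qed.

Lemma additive_powers_wlength x k : additive_powers x ->
  len (x ^+ k) = (k * len x)%N.
Proof.
move=> xadd; elim: k => [|k IHk]; first by rewrite wlength1.
by rewrite -addn1 xadd IHk mulnDl mul1n.
Qed.

(** The orbit [x, t * x, t ^+ 2 * x, ...] never comes back through a wall. *)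
Definition convex_orbit t x := forall r m n,
  inv r (t ^+ (m + n) * x) = inv r x -> inv r (t ^+ m * x) = inv r x.

(** A translate of the orbit by a power of [t] sees the translated walls. *)
Lemma convex_orbit_shift t x r a b c : convex_orbit t x -> (a <= b <= c)%N ->
  inv r (t ^+ a * x) = inv r (t ^+ c * x) ->
  inv r (t ^+ b * x) = inv r (t ^+ a * x).
Proof.
move=> cx /andP[ab bc].
have -> : b = (a + (b - a))%N by rewrite subnKC.
have -> : c = (a + ((b - a) + (c - b)))%N by lia.
rewrite !(expgnDr t a) -!mulgA !(inversionM _ r (t ^+ a)).
by move=> /esym e; congr addb; apply: (cx _ _ (c - b)%N); move: e;
  case: (inv r (t ^+ a)); case: (inv _ x); case: (inv _ _).
Qed.

Lemma convex_orbitX t x k : convex_orbit t x -> convex_orbit (t ^+ k) x.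
Proof. by move=> cx r m n; rewrite -!expgnA mulnDr; apply: cx. Qed.

(** Multiplication by [x] on the left turns the powers of [x^-1 * t * x] into
    the orbit of [x] under [t]. *)
Lemma additive_convex t x :
  additive_powers (x^-1 * t * x) <-> convex_orbit t x.
Proof.
pose a := x^-1 * t * x.
have aX m : a ^+ m = x^-1 * (t ^+ m * x).
  elim: m => [|m IHm]; first by rewrite !expg0 mul1g mulVg.
  by rewrite !expgSr IHm /a; gsimp.
have E r m : inv r (a ^+ m) = inv (x * r * x^-1) x (+) inv (x * r * x^-1) (t ^+ m * x).
  by rewrite aX inversionM inversionV invgK.
split=> [add r m n e|cx m n].
  pose r0 := x^-1 * r * x.
  have E0 p : inv r0 (a ^+ p) = inv r x (+) inv r (t ^+ p * x).
    by rewrite E /r0; gsimp.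
  have addmn := add m n; rewrite expgnDr -/a in addmn.
  have := (wlengthM_additive cox _ _).1 addmn (a ^- m * r0 * a ^+ m).
  rewrite inversionV; have -> : a ^+ m * (a ^- m * r0 * a ^+ m) / a ^+ m = r0.
    by gsimp.
  have := inversionM cox r0 (a ^+ m) (a ^+ n); rewrite -expgnDr !E0 e.
  by case: (inv r x); case: (inv r _); case: (inv _ (a ^+ n)) => //= _ /(_ isT).
rewrite expgnDr; apply/(wlengthM_additive cox) => r.
rewrite inversionV; set r' := a ^+ m * r * a ^- m => h.
have := inversionM cox r' (a ^+ m) (a ^+ n); rewrite h -expgnDr.
have -> : a ^- m * r' * a ^+ m = r by rewrite /r'; gsimp.
have := cx (x * r' * x^-1) m n; move: h; rewrite !(E r').
case: (inv _ x); case: (inv _ (t ^+ m * x)); case: (inv _ (t ^+ (m + n) * x));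
  by case: (inv r _) => // _ /(_ erefl).
Qed.

(** With [g = t q t], which commutes with [q], one has [t g t = g q g], so
    [t ^+ 2 * q * t ^+ 2] centralises [q] and exchanges the two sides of its
    wall, just as [q] does. *)
Lemma reflection_translation t q : is_reflection S q ->
  commute t (q * t * q) ->
  inv q (t ^+ 2 * q * t ^+ 2) /\ commute (t ^+ 2 * q * t ^+ 2) q.
Proof.
move=> rq ct; pose g := t * q * t.
have qV := reflection_inv cox rq.
have cg : commute g q.
  by move: ct; rewrite /commute /g !mulgA => ct; rewrite ct; gsimp.
have e : t ^+ 2 * q * t ^+ 2 = g * q * g.
  have qq := reflection_sq cox rq.
  have t1 : g * t^-1 * q = t by rewrite /g mulgK -mulgA qq mulg1.
  have t2 : q * t^-1 * g = t by rewrite /g; gsimp; rewrite qq mul1g.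
  have qgq : q * g * q = g by rewrite -cg -mulgA qq mulg1.
  have -> : t ^+ 2 * q * t ^+ 2 = t * g * t by rewrite /g !expg2; gsimp.
  rewrite -{1}t1 -{2}t2; have -> : g / t * q * g * (q / t * g) =
    g / t * (q * g * q) / t * g by gsimp.
  by rewrite qgq; congr (_ * g); rewrite {2}/g; gsimp.
have cgq : commute (g * q * g) q.
  apply/commute_sym/commuteM; last exact/commute_sym.
  by apply: commuteM; [exact/commute_sym|exact: commute_refl].
have invM h k : commute h q -> inv q (h * k) = inv q h (+) inv q k.
  by move=> ch; rewrite inversionM -mulgA -ch mulKg.
rewrite e; split=> //; rewrite invM; last first.
  by apply/commute_sym/commuteM; [exact/commute_sym|exact: commute_refl].
by rewrite invM // inversion_self //; case: inversion.
Qed.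

(** The hypothesis on [i0] says that the monotone sequence [f] changes next to
    [i0], so that its value at [i0] may be either of the two. *)
Lemma convex_flip (f g : nat -> bool) i0 :
  (forall a b c, (a <= b <= c)%N -> f a = f c -> f b = f a) ->
  (0 < i0)%N -> f i0.-1 != f i0.+1 ->
  (forall i, g i = f i (+) (i == i0)) ->
  forall a b c, (a <= b <= c)%N -> g a = g c -> g b = g a.
Proof.
move=> cf i00 key gE.
have lo i : (i < i0)%N -> f i = f i0.-1.
  move=> ii; have [e|] := eqVneq (f i) (f i0.+1).
    by rewrite (cf i i0.-1 i0.+1) //; lia.
  by move: key; case: (f i); case: (f i0.-1); case: (f i0.+1).
have hi i : (i0 < i)%N -> f i = f i0.+1.
  move=> ii; have [e|] := eqVneq (f i0.-1) (f i).
    by rewrite -e (cf i0.-1 i0.+1 i) //; lia.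
  by move: key; case: (f i); case: (f i0.-1); case: (f i0.+1).
move=> a b c /andP[ab bc]; rewrite !gE.
case: (ltngtP b i0) => [bi|bi|bi].
- have ai := leq_ltn_trans ab bi.
  by rewrite (lo b bi) (lo a ai) (ltn_eqF ai).
- have ci := leq_trans bi bc.
  by rewrite (hi b bi) (hi c ci) (gtn_eqF ci) => ->.
- move: ab bc; rewrite bi leq_eqVlt => /predU1P[->|ai]; first by rewrite eqxx.
  rewrite leq_eqVlt => /predU1P[->|ci]; first by rewrite eqxx => ->.
  rewrite (lo a) // (hi c) // (ltn_eqF ai) (gtn_eqF ci) !addbF => /eqP e.
  by rewrite e in key.
Qed.

(** Crossing one wall [q] keeps the orbit convex, after replacing [t] by a
    power. If [q] has a finite orbit, a power of [t] fixes both sides of its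
    wall. Otherwise the convex orbit of [x] crosses the wall of [q] between
    [t^-1 x] and [t x], so that moving [x] across it alone is harmless. *)
Lemma convex_orbit_step t x s : S s -> convex_orbit t x ->
  (exists2 m, (0 < m)%N &
    let q := x * s * x^-1 in commute (t ^+ m) (q * t ^+ m * q)) ->
  exists2 m, (0 < m)%N & convex_orbit (t ^+ m) (x * s).
Proof.
move=> Ss cx [m0 m00 /=]; set q := x * s * x^-1 => comm.
have rq : is_reflection S q by exists x, s.
(* the square is what makes [reflection_translation] available *)
pose u := t ^+ m0 ^+ 2.
have [inv_uqu comm_uqu] := reflection_translation rq comm.
have cu : convex_orbit u x by do 2 apply: convex_orbitX.
have uE n : u ^+ n = t ^+ (m0 * 2 * n) by rewrite /u -!expgnA mulnA.
have [[i i0 uq]|inf] := pselect (exists2 i, (0 < i)%N & u ^+ i * q * u ^- i = q).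
  have cq : commute (u ^+ i) q by rewrite /commute -{2}uq; gsimp.
  exists (m0 * 2 * i * 2)%N; first by lia.
  have -> : t ^+ (m0 * 2 * i * 2) = u ^+ i ^+ 2 by rewrite uE -!expgnA.
  set z := u ^+ i ^+ 2.
  have cz p : commute (z ^+ p) q.
    by rewrite /z; apply/commute_sym/commuteX/commuteX/commute_sym.
  have zq y p : inv q (z ^+ p * y) = inv q y.
    elim: p y => [|p IHp] y; first by rewrite mul1g.
    rewrite expgSr -mulgA IHp /z expg2 -mulgA !inversionM.
    rewrite -(mulgA _ q) -cq mulKg -(mulgA _ q) -cq mulKg.
    by rewrite addbA addbb.
  have cz' : convex_orbit z x by do 2 apply: convex_orbitX.
  move=> r m n; have [->|rq'] := eqVneq r q; first by rewrite !zq.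
  have E p : inv r (z ^+ p * (x * s)) = inv r (z ^+ p * x).
    rewrite mulgA inversion_cross // -[RHS]addbF; congr addb.
    apply/negbTE; have -> : z ^+ p * x * s / (z ^+ p * x) = z ^+ p * q / z ^+ p.
      by rewrite /q; gsimp.
    by rewrite cz mulgK.
  have := E 0%N; rewrite expg0 !mul1g => ->; rewrite !E; exact: cz'.
exists (m0 * 2)%N; first by lia.
rewrite expgnA -/u => r m n.
have orbit_lt i j : (i < j)%N -> u ^+ i * q * u ^- i <> u ^+ j * q * u ^- j.
  move=> ij; rewrite -(subnKC (ltnW ij)) expgnDr => e; apply: inf.
  exists (j - i)%N; first by rewrite subn_gt0.
  by have := congr1 (fun z => u ^- i * z * u ^+ i) e; gsimp.
have orbit_inj i j : u ^+ i * q * u ^- i = u ^+ j * q * u ^- j -> i = j.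
  by move=> e; case: (ltngtP i j) => // /orbit_lt; rewrite e.
(* shift the indices by one, so that both neighbours of a crossing are visible *)
pose r' := u * r * u^-1.
have shift y p : inv r' (u ^+ p.+1 * y) = inv r' u (+) inv r (u ^+ p * y).
  by rewrite expgS -mulgA inversionM /r'; gsimp.
pose f i := inv r' (u ^+ i * x); pose g i := inv r' (u ^+ i * (x * s)).
have cf a b c : (a <= b <= c)%N -> f a = f c -> f b = f a.
  by move=> abc e; apply: convex_orbit_shift cu abc e.
have gE i : g i = f i (+) (r' == u ^+ i * q * u ^- i).
  by rewrite /g mulgA inversion_cross // /q; gsimp.
suff cg a b c : (0 < a)%N -> (a <= b <= c)%N -> g a = g c -> g b = g a.
  move=> e; have := cg 1%N m.+1 (m + n).+1 isT.
  rewrite /g !shift !ltnS leq_addr mul1g e => /(_ isT erefl).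
  by case: (inv r' u); case: (inv r (u ^+ m * _)); case: (inv r _).
move=> a0 abc.
have [[i0 ri0]|none] := pselect (exists i, r' = u ^+ i.+1 * q * u ^- i.+1); last first.
  have E i : (0 < i)%N -> g i = f i.
    case: i => // i _; rewrite gE; case: eqP => [e|_]; last exact: addbF.
    by case: none; exists i.
  have [ab bc] := andP abc; have b0 := leq_trans a0 ab.
  by rewrite !E //; [apply: cf|apply: leq_trans bc].
apply: (@convex_flip f g i0.+1 cf) => // [|i]; last first.
  rewrite gE; congr addb; rewrite ri0; apply/eqP/eqP => [/orbit_inj//|->//].
have E y : inv q (u * q * y) = ~~ inv q (u^-1 * y).
  have -> : u * q * y = (u * q * u) * (u^-1 * y) by gsimp.
  by rewrite inversionM inv_uqu -(mulgA _ q) -comm_uqu mulKg.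
have key : inv q (u * x) != inv q (u^-1 * x).
  have := E x; have -> : u * q * x = u * x * s by rewrite /q; gsimp.
  rewrite inversion_cross //; case: eqP => [e|_].
    by case: inf; exists 1%N => //; rewrite expg1 {2}e /q; gsimp.
  by rewrite addbF => ->; case: inversion.
have F p : f p.+2 = inv r' (u ^+ p.+1) (+) inv (u^-(p.+1) * r' * u^+p.+1) (u * x).
  by rewrite /f expgSr -mulgA inversionM.
rewrite -[i0.+1.-1]/i0 F {1}/f.
have -> : u ^+ i0 * x = u ^+ i0.+1 * (u^-1 * x) by rewrite expgSr; gsimp.
rewrite inversionM; have -> : u ^- i0.+1 * r' * u ^+ i0.+1 = q by rewrite ri0; gsimp.
by move: key; case: (inv q (u * x)); case: (inv q _); case: (inv r' _).
Qed.

End Additive.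
Arguments additive_powers {W} S x.

(** * Parabolic subgroups *)

Lemma finite_set_repeat {T} (F : set T) (f : nat -> T) :
  finite_set F -> (forall n, F (f n)) -> exists i j, (i < j)%N /\ f i = f j.
Proof.
move=> finF Ff; apply: contrapT => h; apply: infinite_nat.
have injf : injective f.
  move=> i j fij; apply: contrapT => /eqP; rewrite neq_ltn => /orP[] ij.
    by apply: h; exists i, j.
  by apply: h; exists j, i.
apply: sub_finite_set (finite_preimage (in2W injf) finF) => n _; exact: Ff.
Qed.

Section Parabolic.
Context {W : groupType} {S : set W} (cox : coxeter_system S).
Implicit Types (x y w u v s r : W) (J K I : set W).
Local Notation len := (wlength S).
Local Notation inv := (inversion cox).

Lemma last_letter x : x <> 1 -> exists2 s, S s & len x = (len (x * s)).+1.
Proof.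
have [l [Sl Ul <- zl]] := reducedP cox x; case/lastP: l Sl Ul zl => // l s.
rewrite -cats1 => Sl Ul zl _; have [Sl' /word_cons[Ss _]] := (word_cat _ _ _).1 Sl.
exists s => //; rewrite -zl wprod_cat /= mulg1 -mulgA (gens_sq cox Ss) mulg1.
rewrite (wlength_reduced cox) // ?size_cat ?addn1 //.
by move: Ul; rewrite reflections_cat cat_uniq => /andP[].
Qed.

Lemma wlength_mul_neq v s : S s -> len (v * s) <> len v.
Proof.
move=> Ss; have rs := gens_reflection Ss.
have -> : v * s = (s * v^-1)^-1 by rewrite invgM invgK (gens_inv cox Ss).
rewrite (wlengthV cox) -(wlengthV cox v) => e.
have := inversion_mull cox v^-1 rs.
by rewrite !inversion_wlength // mulgA (gens_sq cox Ss) mul1g e ltnn.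
Qed.

Lemma leq_wlength_mul v s : S s -> (len (v * s) <= (len v).+1)%N.
Proof.
move=> Ss; apply: leq_trans (leq_wlengthM cox _ _) _; rewrite -addn1 leq_add2l.
by have := @leq_wlength_word _ _ cox [:: s]; rewrite /= mulg1; apply; apply/word_cons.
Qed.

Lemma wlength_gen s : S s -> len s = 1%N.
Proof.
move=> Ss; have -> : s = wprod [:: s] by rewrite /= mulg1.
by rewrite (wlength_reduced cox) //; apply/word_cons.
Qed.

Lemma inversion_parabolic K v r : K `<=` S -> gen K v -> inv r v ->
  exists a s, [/\ gen K a, K s & r = a * s * a^-1].
Proof.
move=> KS /(reduced_word cox KS)[l [Kl Ul <-]].
rewrite inversion_reduced => // [|s /Kl/KS//]; elim: l Kl r {Ul} => [//|t l IHl].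
move=> /word_cons[Kt /IHl{}IHl] r /=; rewrite inE => /predU1P[->|].
  by exists 1, t; split=> //; [exact: gen1|gsimp].
move=> /mapP[r' /IHl[a [s [Ka Ks ->]]] ->]; exists (t * a), s; split=> //.
  by apply: genM => //; apply: sub_gen.
by gsimp.
Qed.

(** Take [y] shortest in [x * gen K]. No wall of a reflection in [gen K]
    separates [1] from [y^-1], since that reflection would make [y] shorter. *)
Lemma min_coset K x : K `<=` S -> exists y v, [/\ gen K v, x = y * v
  & forall v', gen K v' -> len (y * v') = (len y + len v')%N].
Proof.
move=> KS; pose P n := `[< exists2 v, gen K v & len (x * v) = n >].
have exP : exists n, P n.
  by exists (len x); apply/asboolP; exists 1; rewrite ?mulg1 //; apply: gen1.
case: (ex_minnP exP) => n /asboolP[v Kv vn] minn.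
exists (x * v), v^-1; split; [exact: genV|by gsimp|move=> v' Kv'].
apply/(wlengthM_additive cox) => r ry; apply/negP => rv'.
have [a [s [Ka Ks e]]] := inversion_parabolic KS Kv' rv'.
have Kr : gen K r.
  by rewrite e; apply: genM (genV Ka); apply: genM => //; apply: sub_gen.
have rr : is_reflection S r by exists a, s; split=> //; apply: KS.
move: ry; rewrite inversion_wlength // wlengthV // -(wlengthV cox (r * _)).
rewrite invgM invgK ltnNge vn => /negP; apply; apply: minn; apply/asboolP.
by exists (v * r^-1); [apply: genM Kv (genV Kr)|rewrite mulgA].
Qed.

(** Write [x = y * v0] with [y] shortest in [x * gen K]: if [v0 <> 1], its last
    letter in [K] is a descent of [x]. *)
Lemma no_descent_additive K x : K `<=` S ->
  (forall s, K s -> ~~ inv s x^-1) ->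
  forall v, gen K v -> len (x * v) = (len x + len v)%N.
Proof.
move=> KS nd; have [y [v0 [Kv0 e yadd]]] := min_coset x KS.
have [l [Kl Ul e0]] := reduced_word cox KS Kv0.
have Sl : word S l by move=> s /Kl/KS.
case/lastP: l Kl Ul e0 Sl => [_ _ e0 _|l s Kl Ul e0 Sl].
  by move=> v Kv; move: e; rewrite -e0 mulg1 => ->; apply: yadd.
move: Kl; rewrite -cats1 => /word_cat[Kl /word_cons[Ks _]].
have Ss := KS _ Ks; have := nd s Ks.
rewrite inversion_wlength; last exact: gens_reflection.
have -> : s * x^-1 = (x * s)^-1 by rewrite invgM (gens_inv cox Ss).
rewrite !(wlengthV cox) e -mulgA !yadd //; last first.
  by apply: genM => //; apply: sub_gen.
rewrite ltn_add2l -e0 -cats1 wprod_cat /= mulg1 -mulgA (gens_sq cox Ss) mulg1.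
have -> : len (wprod l * s) = (size l).+1.
  have := wlength_reduced cox Sl Ul; rewrite -cats1 wprod_cat /= mulg1 => ->.
  by rewrite size_cat addn1.
rewrite ltnS (leq_wlength_word cox) // => t tl; apply: Sl.
by rewrite mem_rcons inE tl orbT.
Qed.

(** Otherwise [s] is conjugate to some [t] in [J] by an element of [gen J],
    which commutes with [s]; so [s = t]. *)
Lemma no_descent_perp J x s : J `<=` S -> gen J x -> Jperp S J s ->
  ~~ inv s x^-1.
Proof.
move=> JS Jx [Ss nJs cs]; apply/negP.
move=> /(inversion_parabolic JS (genV Jx))[a [t [Ja Jt e]]]; apply: nJs.
have cas : commute s a.
  by apply: (gen_min (centralizer_subgroup s) _ Ja) => j /cs.
suff -> : s = t by [].
by rewrite -[s](mulKg a) -cas e; gsimp.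
Qed.

(** If [x = y * v] with [y] shortest in [x * gen I], then [x ^+ k] lies in
    [y ^+ k * gen I], so that its length, [k * (len y + len v)], is at most
    [k * len y] up to a constant. *)
Lemma no_descent_normalized I x s : I `<=` S -> finite_set (gen I) ->
  conjs x (gen I) = gen I -> additive_powers S x -> I s -> ~~ inv s x^-1.
Proof.
move=> IS finI nI xadd Is; have Ss := IS _ Is.
have [y [v [Iv e yadd]]] := min_coset x IS.
have v1 : v = 1.
  have [M MP] : exists M, forall z, gen I z -> (len z <= M)%N.
    have [l lP] := (finite_seqP _).1 finI.
    exists (\max_(z <- l) len z)%N => z; rewrite lP /= => zl.
    by rewrite (big_rem z) //= leq_maxl.
  have yX k : exists2 z, gen I z & x ^+ k = y ^+ k * z.
    elim: k => [|k [z Iz IHk]]; first by exists 1; [exact: gen1|rewrite mulg1].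
    have xzx : gen I (x^-1 * z * x) by apply/conjsP; rewrite nI.
    exists (v * (x^-1 * z * x)).
      exact: genM.
    by rewrite expgSr IHk (expgSr y) {1 3}e e; gsimp.
  have leX k : (len (y ^+ k) <= k * len y)%N.
    elim: k => [|k IHk]; first by rewrite wlength1.
    rewrite expgS mulSn; apply: leq_trans (leq_wlengthM cox _ _) _.
    by rewrite leq_add2l.
  apply: (wlength_eq0 cox); have [z Iz ez] := yX M.+1.
  have := additive_powers_wlength cox M.+1 xadd.
  rewrite ez [in len x]e yadd // => eM.
  have := leq_wlengthM cox (y ^+ M.+1) z; have := leX M.+1; have := MP z Iz.
  by rewrite eM; nia.
have xy : x = y by rewrite e v1 mulg1.
rewrite inversion_wlength; last exact: gens_reflection.
have -> : s * x^-1 = (x * s)^-1 by rewrite invgM (gens_inv cox Ss).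
by rewrite !(wlengthV cox) xy yadd ?ltnNge ?leq_addr //; apply: sub_gen.
Qed.

Lemma normalized_power_central (A : set W) x s : finite_set A ->
  conjs x A = A -> A s -> exists2 p, (0 < p)%N & commute (x ^+ p) s.
Proof.
move=> finA nA As; pose f n := x ^+ n * s * x ^- n.
have fA n : A (f n).
  rewrite /f; elim: n => [|n IHn]; first by rewrite expg0; gsimp.
  rewrite -nA; apply/conjsP; rewrite expgS; gsimp.
  by move: IHn; gsimp.
have [i [j [ij]]] := finite_set_repeat finA fA.
rewrite /f -(subnKC (ltnW ij)) expgnDr => e; exists (j - i)%N.
  by rewrite subn_gt0.
have := congr1 (fun z => x ^- i * z * (x ^+ i * x ^+ (j - i))) e.
by gsimp => e'; rewrite /commute e'.
Qed.

Lemma normalizedX (A : set W) x k : conjs x A = A -> conjs (x ^+ k) A = A.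
Proof.
by move=> nA; elim: k => [|k IHk]; rewrite ?conjs1 // expgS conjsM IHk.
Qed.

Lemma component_sub J K : component J K -> K `<=` J.
Proof. by move=> [s Js ->] t []. Qed.

Lemma component_commute J K s t : J `<=` S -> component J K ->
  K s -> (J `\` K) t -> commute s t.
Proof.
move=> JS [s0 _ ->] [Js ls] [Jt nKt]; apply: contrapT => nc; apply: nKt.
split=> //; apply: Relation_Operators.rt_trans ls _.
apply: Relation_Operators.rt_step; split=> //.
rewrite expg2 => /mulg1_eq; rewrite invgM !(gens_inv cox) //; try exact: JS.
by move=> e; apply: nc; rewrite /commute e.
Qed.

Lemma component_gen_commute J K x y : J `<=` S -> component J K ->
  gen K x -> gen (J `\` K) y -> commute x y.
Proof.
move=> JS cK Kx Ky; apply: (gen_min (centralizer_subgroup x) _ Ky) => t Kt /=.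
apply/commute_sym; apply: (gen_min (centralizer_subgroup t) _ Kx) => s Ks /=.
exact/commute_sym/(component_commute JS cK).
Qed.

Lemma component_split J K x : J `<=` S -> component J K -> gen J x ->
  exists2 u, gen K u & exists2 v, gen (J `\` K) v & x = u * v.
Proof.
move=> JS cK; apply: (@gen_min _ J [set x | exists2 u, gen K u &
  exists2 v, gen (J `\` K) v & x = u * v]) => [|s Js].
  split=> [|_ _ [u Ku [v Kv ->]] [u' Ku' [v' Kv' ->]]|_ [u Ku [v Kv ->]]].
  - by exists 1; [exact: gen1|exists 1; [exact: gen1|rewrite mulg1]].
  - exists (u * u'); first exact: genM.
    exists (v * v'); first exact: genM.
    rewrite -mulgA (mulgA v) -(component_gen_commute JS cK Ku' Kv); gsimp.
    by [].
  - exists u^-1; first exact: genV.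
    exists v^-1; first exact: genV.
    by rewrite (component_gen_commute JS cK Ku Kv) invgM.
have [Ks|nKs] := pselect (K s).
  by exists s; [exact: sub_gen|exists 1; [exact: gen1|rewrite mulg1]].
exists 1; first exact: gen1.
by exists s; [exact: sub_gen|rewrite mul1g].
Qed.

(** The factors of [w] in the other components centralise [gen I]. *)
Lemma Jsph_normalized J w s : J `<=` S -> Jsph J w s -> exists I,
  [/\ I `<=` S, I s, finite_set (gen I) & conjs w (gen I) = gen I].
Proof.
move=> JS [K [u [I [cK _ [Ku [v Kv ->]] [IK [[_ finI nI] _]] Is]]]].
exists I; split=> //; first by move=> x /IK/(component_sub cK)/JS.
rewrite conjsM -[RHS]nI; congr conjs; apply/seteqP.
have cI x : gen I x -> commute x v.
  by move=> /(genS IK) Kx; apply: component_gen_commute cK Kx Kv.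
have E x : gen I x -> v^-1 * x * v = x by move=> /cI e; rewrite -mulgA e mulKg.
split=> x; first by move=> [y Iy <-]; rewrite -(cI _ Iy) mulgK.
by move=> Ix; apply/conjsP; rewrite E.
Qed.

(** A power of [w] centralises [v] since [w] normalises finite groups
    generating [gen (Jsph J w)], and centralises [Jperp S J]. *)
Lemma residue_power J w v : J `<=` S -> gen J w -> straight S w ->
  gen (Jperp S J `|` Jsph J w) v ->
  exists p, [/\ (0 < p)%N, commute (w ^+ p) v
    & forall k, len (w ^+ p ^+ k * v) = (len (w ^+ p ^+ k) + len v)%N /\
        len (w ^+ p ^+ k * v^-1) = (len (w ^+ p ^+ k) + len v^-1)%N].
Proof.
move=> JS Jw sw Kv; set K := _ `|` _ in Kv.
have wadd := straight_additive sw.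
have KS : K `<=` S.
  by move=> s [[]//|/(Jsph_normalized JS)[I [IS Is _ _]]]; apply: IS.
have [p p0 cp] : exists2 p, (0 < p)%N & commute (w ^+ p) v.
  apply: (gen_min (power_centralizer_subgroup w) _ Kv) => s [[_ _ cs]|].
    exists 1%N => //; apply/commute_sym.
    exact: (gen_min (centralizer_subgroup s) _ Jw) => j /cs.
  move=> /(Jsph_normalized JS)[I [IS Is finI nI]].
  by apply: normalized_power_central finI nI _; apply: sub_gen.
exists p; split=> // k.
suff nd s : K s -> ~~ inv s (w ^+ p ^+ k)^-1.
  by split; apply: (no_descent_additive KS) => //; apply: genV.
case=> [ps|].
  by apply: no_descent_perp ps => //; do 2 apply: genX.
move=> /(Jsph_normalized JS)[I [IS Is finI nI]].
apply: no_descent_normalized IS finI _ _ Is.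
  by do 2 apply: normalizedX.
by do 2 apply: additive_powersX.
Qed.

(** Up to a power, the component of [w] in an affine component [K] lies in an
    abelian subgroup of finite index of [gen K], as do its conjugates. *)
Lemma affine_power_commute J w x s : J `<=` S -> gen J w ->
  gen (Jaff J) x -> Jaff J s -> exists2 m, (0 < m)%N &
    let q := x * s * x^-1 in commute (w ^+ m) (q * w ^+ m * q).
Proof.
move=> JS Jw Lx [K [cK [_ _ [A [subA AK cA [F finF KF]]]] Ks]] /=.
have LJ : Jaff J `<=` J by move=> t [K' [cK' _ /(component_sub cK')]].
have [u Ku [v Kv ew]] := component_split JS cK Jw.
have [y Ky [z Kz ex]] := component_split JS cK (genS LJ Lx).
have cuv := component_gen_commute JS cK.
set q := x * s * x^-1.
have qE : q = y * s * y^-1.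
  by rewrite /q ex invgM -(mulgA y z s) -(cuv s z (sub_gen Ks) Kz); gsimp.
have Kq : gen K q.
  by rewrite qE; apply: genM (genV Ky); apply: genM => //; apply: sub_gen.
have powA a : gen K a -> exists2 i, (0 < i)%N & A (a ^+ i).
  move=> Ka; have /choice[f fP] n : exists f, F f /\ A (f^-1 * a ^+ n).
    by have [f Ff [b Ab <-]] := KF _ (genX n Ka); exists f; rewrite mulKg.
  have [i [j [ij e]]] := finite_set_repeat finF (fun n => (fP n).1).
  exists (j - i)%N; first by rewrite subn_gt0.
  have [_ AM AV] := subA.
  have := AM _ _ (AV _ (fP i).2) (fP j).2; rewrite e; gsimp.
  by rewrite -{1}(subnKC (ltnW ij)) expgnDr mulKg.
have qq : q * q = 1.
  apply: (reflection_sq cox); exists x, s; split=> //.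
  exact/JS/(component_sub cK).
have qV : q^-1 = q by apply: mulg1_eq.
have [i i0 Ai] := powA _ Ku.
have [j j0 Aj] := powA (q * u * q) (genM (genM Kq Ku) Kq).
exists (i * j)%N; first by rewrite muln_gt0 i0.
have conjX k : (q * u * q) ^+ k = q * u ^+ k * q.
  by have := conjXg u q k; rewrite !conjgE qV; gsimp.
have wX k : w ^+ k = u ^+ k * v ^+ k by rewrite ew expgMn //; apply: cuv.
have cu : commute (u ^+ (i * j)) (q * u ^+ (i * j) * q).
  rewrite -conjX {2}mulnC !expgnA; apply: commuteX2.
  exact: cA.
have Kvk k : gen (J `\` K) (v ^+ k) by apply: genX.
rewrite wX; set U := u ^+ _ in cu *; set V := v ^+ _.
have KU : gen K U by apply: genX.
have -> : q * (U * V) * q = (q * U * q) * V.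
  have cqV : q * V = V * q := cuv _ _ Kq (Kvk _).
  by rewrite (mulgA q) -(mulgA (q * U)) -cqV mulgA.
have KqU : gen K (q * U * q) by exact: genM (genM Kq KU) Kq.
have cUV : commute U V := cuv _ _ KU (Kvk _).
have cXV : commute (q * U * q) V := cuv _ _ KqU (Kvk _).
have cX : commute (q * U * q) (U * V) by exact: (commuteM (commute_sym cu) cXV).
have cV : commute V (U * V) by exact: (commuteM (commute_sym cUV) (commute_refl V)).
exact: (commuteM (commute_sym cX) (commute_sym cV)).
Qed.

(** The conjugates of [w] by [gen (Jaff J)] have a straight power: walk from
    [1] to [v], correcting the power at each wall. *)
Lemma affine_conjugate_additive J w v : J `<=` S -> gen J w -> straight S w ->
  gen (Jaff J) v -> exists2 m, (0 < m)%N &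
    additive_powers S (v^-1 * w ^+ m * v).
Proof.
move=> JS Jw sw Lv.
have LJ : Jaff J `<=` J by move=> t [K' [cK' _ /(component_sub cK')]].
have LS : Jaff J `<=` S by move=> t /LJ/JS.
have [l Ll <-] := gen_word cox LS Lv.
suff [m m0 cm] : exists2 m, (0 < m)%N & convex_orbit cox (w ^+ m) (wprod l).
  by exists m => //; apply/(additive_convex cox).
elim/last_ind: l Ll => [_|l s IHl].
  exists 1%N => //; apply/(additive_convex cox).
  rewrite expg1 invg1 mul1g mulg1; exact: straight_additive.
rewrite -cats1 => /word_cat[Ll /word_cons[Ls _]].
have [m m0 cm] := IHl Ll.
have [n n0 cn] := affine_power_commute JS Jw (word_gen Ll) Ls.
have [|k k0 ck] := convex_orbit_step (LS _ Ls) cm.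
  exists n => //=; set q := wprod l * s * _ in cn *.
  have rq : is_reflection S q by exists (wprod l), s; split=> //; apply: LS.
  have conjX i : (q * w ^+ n * q) ^+ i = q * w ^+ n ^+ i * q.
    by have := conjXg (w ^+ n) q i; rewrite !conjgE (reflection_inv cox rq); gsimp.
  by rewrite -expgnA mulnC expgnA -conjX; apply: commuteX2.
exists (m * k)%N; first by rewrite muln_gt0 m0.
by rewrite expgnA wprod_cat /= mulg1.
Qed.

End Parabolic.

(** * The BN-pair of an RGD system *)
Section BNpair.
Context {W G : groupType} {S : set W} {U : set W -> set G}.
Context (cox : coxeter_system S) (rgd : rgd_system S U).
Context (lift : W -> G) (liftP : forall v, NtoW S U (lift v) v).
Implicit Types (v w s : W) (g h k n t u x y : G).
Local Notation len := (wlength S).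
Local Notation root := (coxeter_root S).
Local Notation alpha := (simple_root S).
Local Notation T := (torus S U).
Local Notation Up := (Uplus S U).
Local Notation B := (borel S U).
Local Notation N := (NtoW S U).

Lemma rootgroup_subgroup a : root a -> is_subgroup (U a).
Proof. by move=> ra; have [/(_ a ra)[]] := rgd. Qed.

Lemma rootgroup_Uplus a x : root a -> a 1 -> U a x -> Up x.
Proof. by move=> ra a1 Ux; apply: sub_gen; exists a. Qed.

Lemma Uplus1 : Up 1. Proof. exact: gen1. Qed.
Lemma UplusM x y : Up x -> Up y -> Up (x * y). Proof. exact: genM. Qed.
Lemma UplusV x : Up x -> Up x^-1. Proof. exact: genV. Qed.

Lemma torusV t : T t -> T t^-1.
Proof. by move=> Tt a ra; rewrite -{1}(Tt a ra) -conjsM mulVg conjs1. Qed.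

Lemma torusM t t' : T t -> T t' -> T (t * t').
Proof. by move=> Tt Tt' a ra; rewrite conjsM Tt' // Tt. Qed.

Lemma torus1 : T 1. Proof. by move=> a ra; rewrite conjs1. Qed.

Lemma NtoW_conjs n v a : N n v -> root a -> conjs n (U a) = U (ltrans v a).
Proof.
move=> Nn; elim: Nn a => {n v}.
- by move=> t Tt a ra; rewrite ltrans1 Tt.
- by move=> s u m Ss Uu u1 [u' [u'' [_ _ _ mU]]] a; apply: mU.
- move=> n n' v v' _ IHn _ IHn' a ra.
  by rewrite conjsM IHn' // IHn ?ltransM //; apply: coxeter_root_ltrans.
- move=> n v _ IHn a ra; have ra' := coxeter_root_ltrans v^-1 ra.
  by rewrite -{1}[a]ltrans1 -(mulgV v) ltransM -IHn // -conjsM mulVg conjs1.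
Qed.

Lemma NtoW_rootgroup n v a x : N n v -> root a -> U a x ->
  U (ltrans v a) (n * x * n^-1).
Proof. by move=> Nn ra Ux; rewrite -(NtoW_conjs Nn ra); exists x. Qed.

Lemma NtoW1 n : N n 1 -> T n.
Proof. by move=> Nn a ra; rewrite (NtoW_conjs Nn ra) ltrans1. Qed.

Lemma NtoW_VM n n' v : N n v -> N n' v -> T (n^-1 * n').
Proof.
by move=> Nn Nn'; apply: NtoW1; rewrite -(mulVg v); apply/NtoW_mul/Nn'/NtoW_inv.
Qed.

Lemma NtoW_torus_conj n v t : N n v -> T t -> T (n^-1 * t * n).
Proof.
move=> Nn Tt; apply: NtoW1; have -> : 1 = v^-1 * 1 * v by gsimp.
by apply: (NtoW_mul (NtoW_mul (NtoW_inv Nn) (NtoW_torus Tt)) Nn).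
Qed.

Lemma torus_Uplus t x : T t -> Up x -> Up (t * x * t^-1).
Proof.
move=> Tt Ux.
suff : conjs t^-1 Up x by move/conjsP; rewrite invgK.
apply: (gen_min (subgroup_conjs _ (gen_subgroup _)) _ Ux) => y [a [ra a1] Uy].
apply/conjsP; rewrite invgK; apply: (rootgroup_Uplus ra a1).
by rewrite -(Tt a ra); exists y.
Qed.

Lemma borelP g : B g <-> exists t x, [/\ T t, Up x & g = t * x].
Proof.
split=> [[t Tt [x Ux <-]]|[t [x [Tt Ux ->]]]]; first by exists t, x.
by exists t => //; exists x.
Qed.

Lemma borelM g h : B g -> B h -> B (g * h).
Proof.
move=> /borelP[t [x [Tt Ux ->]]] /borelP[t' [x' [Tt' Ux' ->]]].
apply/borelP; exists (t * t'), (t'^-1 * x * t' * x'); split.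
- exact: torusM.
- by apply: UplusM => //; have := torus_Uplus (torusV Tt') Ux; rewrite invgK.
- by gsimp.
Qed.

Lemma torus_borel t : T t -> B t.
Proof.
by move=> Tt; apply/borelP; exists t, 1; rewrite mulg1; split=> //; apply: Uplus1.
Qed.

Lemma Uplus_borel x : Up x -> B x.
Proof.
by move=> Ux; apply/borelP; exists 1, x; rewrite mul1g; split=> //; apply: torus1.
Qed.

Lemma borel1 : B 1. Proof. exact/torus_borel/torus1. Qed.

Lemma borelV g : B g -> B g^-1.
Proof.
move=> /borelP[t [x [Tt Ux ->]]]; rewrite invgM; apply: borelM.
  exact: Uplus_borel (UplusV Ux).
exact/torus_borel/torusV.
Qed.

Lemma borel_Uplus g x : B g -> Up x -> Up (g * x * g^-1).
Proof.
move=> /borelP[t [y [Tt Uy ->]]] Ux.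
have -> : t * y * x * (t * y)^-1 = t * (y * x * y^-1) * t^-1 by gsimp.
by apply: torus_Uplus => //; apply: UplusM (UplusV Uy); apply: UplusM.
Qed.

Lemma opposite_mE s u : S s -> U (alpha s) u -> u <> 1 -> exists u' m u'',
  [/\ U (~` alpha s) u', U (~` alpha s) u'', N m s & u = u' * m * u''].
Proof.
move=> Ss Uu u1; have [_ [_ mex _ _]] := rgd.
have [m mm] := mex s u Ss Uu u1; have Nm := NtoW_m Ss Uu u1 mm.
have [u' [u'' [Uu' Uu'' em _]]] := mm.
have [_ _ UV] := rootgroup_subgroup (coxeter_rootC cox (root_simple Ss)).
exists u'^-1, m, u''^-1; split=> //; [exact: UV|exact: UV|].
by rewrite em; gsimp.
Qed.

Lemma gens_conj_neg s n x : S s -> N n s -> U (~` alpha s) x ->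
  U (alpha s) (n^-1 * x * n).
Proof.
move=> Ss Nn Ux; have rs := coxeter_rootC cox (root_simple Ss).
have := NtoW_rootgroup (NtoW_inv Nn) rs Ux.
by rewrite invgK (gens_inv cox Ss) ltransC (ltrans_simple cox Ss) setCK.
Qed.

Lemma gens_conj_pos s n x : S s -> N n s -> U (alpha s) x ->
  U (~` alpha s) (n * x * n^-1).
Proof.
move=> Ss Nn Ux; have := NtoW_rootgroup Nn (root_simple Ss) Ux.
by rewrite (ltrans_simple cox Ss).
Qed.

Lemma conj_commutator u x : u * x * u^-1 = x * [~ x, u^-1].
Proof. by rewrite /commg /conjg; gsimp. Qed.

(** These elements fix the chambers [u^-1 * n * B], which are all the chambers
    [s]-adjacent to the fundamental one. *)
Definition panel_fixer s n : set G :=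
  [set x | Up x /\ forall u, U (alpha s) u -> Up (n^-1 * (u * x * u^-1) * n)].

Lemma panel_fixer_subgroup s n : is_subgroup (panel_fixer s n).
Proof.
split=> [|x y [Ux xP] [Uy yP]|x [Ux xP]].
- by split=> [|u _]; gsimp; exact: Uplus1.
- split=> [|u Uu]; first exact: UplusM.
  have -> : n^-1 * (u * (x * y) * u^-1) * n =
    (n^-1 * (u * x * u^-1) * n) * (n^-1 * (u * y * u^-1) * n) by gsimp.
  by apply: UplusM; [apply: xP|apply: yP].
- split=> [|u Uu]; first exact: UplusV.
  have -> : n^-1 * (u * x^-1 * u^-1) * n = (n^-1 * (u * x * u^-1) * n)^-1 by gsimp.
  exact: UplusV (xP _ Uu).
Qed.

(** Let [u] be a nontrivial element of the root group of [alpha s]. If [a] and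
    [alpha s] are prenilpotent, [u] conjugates the root group of [a] into the
    root groups of an interval not containing [alpha s], on which [s] acts
    without changing signs. If they are not, [a] and the opposite of [alpha s]
    are, and [u = u' * m * u''] with [u'] and [u''] in the opposite root group
    lets one argue likewise. *)
Lemma rootgroup_panel_fixer s n a x : S s -> N n s -> root a -> a 1 ->
  a <> alpha s -> U a x -> panel_fixer s n x.
Proof.
move=> Ss Nn ra a1 aNs Ux; have rs := root_simple Ss.
have [_ [comm _ _ _]] := rgd.
have neg_pos c y : root c -> c 1 -> c <> alpha s -> U c y -> Up (n^-1 * y * n).
  move=> rc c1 cNs Uy.
  have := NtoW_rootgroup (NtoW_inv Nn) rc Uy; rewrite invgK (gens_inv cox Ss).
  apply: rootgroup_Uplus; first exact: coxeter_root_ltrans.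
  apply/ltransP; rewrite (gens_inv cox Ss) mulg1.
  exact: (root_pos_gen cox).
split=> [|u Uu]; first exact: rootgroup_Uplus ra a1 Ux.
have [-> |u1] := pselect (u = 1).
  by rewrite mul1g invg1 mulg1; apply: neg_pos ra a1 aNs Ux.
have [pre|npre] := pselect ((~` a `&` ~` alpha s) !=set0).
  rewrite conj_commutator.
  have -> : n^-1 * (x * [~ x, u^-1]) * n =
    (n^-1 * x * n) * (n^-1 * [~ x, u^-1] * n) by gsimp.
  apply: UplusM; first exact: neg_pos ra a1 aNs Ux.
  have inC : commutator_subgroup (U a) (U (alpha s)) [~ x, u^-1].
    apply: sub_gen; exists x => //; exists u^-1 => //.
    by have [_ _] := rootgroup_subgroup rs; apply.
  have pos : a `&` alpha s !=set0 by exists 1; split=> //; apply: (simple_root1 cox).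
  have := comm a (alpha s) ra rs aNs pos pre _ inC.
  move=> /(gen_min (subgroup_conjs n (gen_subgroup _)))P.
  suff /P : \bigcup_(c in rgd_interval S a (alpha s)) U c `<=` conjs n Up.
    by move=> /conjsP.
  move=> y [c [rc [_ cNs] ca _] Uy]; apply/conjsP; apply: neg_pos rc _ cNs Uy.
  by apply: ca; split=> //; apply: (simple_root1 cox).
have [u' [m [u'' [Uu' Uu'' Nm eu]]]] := opposite_mE Ss Uu u1.
have -> : n^-1 * (u * x * u^-1) * n =
    (n^-1 * u' * n) * ((n^-1 * m) * (u'' * x * u''^-1) * (n^-1 * m)^-1)
      * (n^-1 * u' * n)^-1 by rewrite eu; gsimp.
have Up' : Up (n^-1 * u' * n).
  apply: (rootgroup_Uplus rs) => //; first exact: (simple_root1 cox).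
  exact: gens_conj_neg.
apply: UplusM (UplusV Up'); apply: UplusM => //.
apply: torus_Uplus; first exact: NtoW_VM Nn Nm.
rewrite conj_commutator; apply: UplusM; first exact: rootgroup_Uplus ra a1 Ux.
have rs' := coxeter_rootC cox rs.
have inC : commutator_subgroup (U a) (U (~` alpha s)) [~ x, u''^-1].
  apply: sub_gen; exists x => //; exists u''^-1 => //.
  by have [_ _] := rootgroup_subgroup rs'; apply.
have aNs' : a <> ~` alpha s.
  by move=> e; move: a1; rewrite e; apply; apply: (simple_root1 cox).
have as_ : a s by apply: (root_pos_gen cox).
have pos : a `&` ~` alpha s !=set0 by exists s; split=> //; apply: (simple_root_self cox).
have pos' : ~` a `&` ~` ~` alpha s !=set0.
  have [z nz] := root_neq0 cox (coxeter_rootC cox ra); exists z; split=> // nzs.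
  by apply: npre; exists z.
have := comm a _ ra rs' aNs' pos pos' _ inC.
apply: genS => y [c [rc [_ cNs] ca _] Uy]; exists c => //; split=> //.
apply: contrapT => nc1; apply: cNs.
rewrite -(root_separating cox Ss (coxeter_rootC cox rc)) ?setCK //.
by move=> ncs; apply: ncs; apply: ca; split=> //; apply: (simple_root_self cox).
Qed.

(** [panel_fixer s n] is normalised by the root group of [alpha s] and contains
    the other positive root groups. *)
Lemma Uplus_split s n x : S s -> N n s -> Up x ->
  exists2 u, U (alpha s) u & exists2 y, panel_fixer s n y & x = u * y.
Proof.
move=> Ss Nn; have rs := root_simple Ss.
have [U1 UM UV] := rootgroup_subgroup rs.
have [P1 PM PV] := panel_fixer_subgroup s n.
have Pn u y : U (alpha s) u -> panel_fixer s n y -> panel_fixer s n (u * y * u^-1).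
  move=> Uu [Uy yP]; have Upu := rootgroup_Uplus rs (simple_root1 cox Ss) Uu.
  split=> [|v Uv]; first by apply: UplusM (UplusV Upu); apply: UplusM.
  have -> : v * (u * y * u^-1) * v^-1 = (v * u) * y * (v * u)^-1 by gsimp.
  exact: yP _ (UM _ _ Uv Uu).
apply: (@gen_min _ _ [set x | exists2 u, U (alpha s) u &
  exists2 y, panel_fixer s n y & x = u * y]) => [|y [a [ra a1] Uy]].
  split=> [|_ _ [u Uu [y Py ->]] [u' Uu' [y' Py' ->]]|_ [u Uu [y Py ->]]].
  - by exists 1 => //; exists 1; rewrite ?mulg1.
  - exists (u * u'); first exact: UM.
    exists (u'^-1 * y * u' * y'); last by gsimp.
    by apply: PM => //; have := Pn _ _ (UV _ Uu') Py; rewrite invgK.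
  - exists u^-1; first exact: UV.
    exists (u * y^-1 * u^-1); last by gsimp.
    by apply: Pn => //; apply: PV.
have [ea|na] := pselect (a = alpha s).
  by exists y; [rewrite -ea|exists 1; rewrite ?mulg1].
exists 1 => //; exists y; rewrite ?mul1g //.
exact: rootgroup_panel_fixer ra a1 na Uy.
Qed.

Lemma borel_split s n g : S s -> N n s -> B g ->
  exists2 u, U (alpha s) u &
    exists h, [/\ B h, B (n^-1 * h * n) & g = u * h].
Proof.
move=> Ss Nn /borelP[t [x [Tt Ux ->]]].
have [u Uu [y [Uy yP] e]] := Uplus_split Ss Nn (torus_Uplus Tt Ux).
exists u => //; exists (y * t); split.
- by apply: borelM; [exact: Uplus_borel|exact: torus_borel].
- have -> : n^-1 * (y * t) * n = (n^-1 * y * n) * (n^-1 * t * n) by gsimp.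
  apply: borelM; last exact/torus_borel/(NtoW_torus_conj Nn).
  apply: Uplus_borel; have [U1 _ _] := rootgroup_subgroup (root_simple Ss).
  by have := yP _ U1; gsimp.
- by rewrite mulgA -e; gsimp.
Qed.

Definition cell v : set G := [set g | exists2 n, N n v & mulset B (ltrans n B) g].

Lemma cellP v n g : N n v ->
  cell v g <-> exists b b', [/\ B b, B b' & g = b * n * b'].
Proof.
move=> Nn; split=> [[n' Nn' [b Bb [_ [b' Bb' <-] <-]]]|[b [b' [Bb Bb' ->]]]].
  exists b, (n^-1 * n' * b'); split=> //; last by gsimp.
  by apply: borelM => //; apply/torus_borel/(NtoW_VM Nn Nn').
by exists n => //; exists b => //; exists (n * b'); [exists b'|rewrite mulgA].
Qed.

Lemma NtoW_cell n v : N n v -> cell v n.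
Proof.
by move=> Nn; apply/(cellP _ Nn); exists 1, 1; gsimp; split=> //; exact: borel1.
Qed.

Lemma cell1P g : cell 1 g <-> B g.
Proof.
rewrite (cellP _ (NtoW_torus torus1)); split=> [[b [b' [Bb Bb' ->]]]|Bg].
  by rewrite mulg1; apply: borelM.
by exists g, 1; gsimp; split=> //; exact: borel1.
Qed.

Lemma cellV v g : cell v g -> cell v^-1 g^-1.
Proof.
move=> /(cellP _ (liftP v))[b [b' [Bb Bb' ->]]].
apply/(cellP _ (NtoW_inv (liftP v))); exists b'^-1, b^-1.
by split; [exact: borelV|exact: borelV|gsimp].
Qed.

Lemma cell_borell v b g : B b -> cell v g -> cell v (b * g).
Proof.
move=> Bb /(cellP _ (liftP v))[c [c' [Bc Bc' ->]]].
by apply/(cellP _ (liftP v)); exists (b * c), c'; split; [exact: borelM| |gsimp].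
Qed.

Lemma cell_borelr v b g : B b -> cell v g -> cell v (g * b).
Proof.
move=> Bb /(cellP _ (liftP v))[c [c' [Bc Bc' ->]]].
by apply/(cellP _ (liftP v)); exists c, (c' * b); split; [|exact: borelM|gsimp].
Qed.

Lemma cell_split v w g : cell (v * w) g ->
  exists h k, [/\ cell v h, cell w k & g = h * k].
Proof.
have Nvw := NtoW_mul (liftP v) (liftP w).
move=> /(cellP _ Nvw)[b [b' [Bb Bb' ->]]].
exists (b * lift v), (lift w * b'); split; last by gsimp.
  exact/cell_borell/NtoW_cell/liftP.
exact/cell_borelr/NtoW_cell/liftP.
Qed.

(** This is [opposite_mE] conjugated by a lift of [s]. *)
Lemma cell_opposite s u : S s -> U (~` alpha s) u -> u <> 1 -> cell s u.
Proof.
move=> Ss Uu u1; have Ns := liftP s; have rs := root_simple Ss.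
have Uu2 := gens_conj_neg Ss Ns Uu.
have [|u' [m [u'' [Uu' Uu'' Nm e]]]] := opposite_mE Ss Uu2.
  move=> e; apply: u1.
  have -> : u = lift s * ((lift s)^-1 * u * lift s) * (lift s)^-1 by gsimp.
  by rewrite e; gsimp.
have pos y : U (~` alpha s) y -> B (lift s * y * (lift s)^-1).
  move=> Uy; apply: Uplus_borel; apply: (rootgroup_Uplus rs (simple_root1 cox Ss)).
  have NsV : N (lift s)^-1 s.
    by rewrite -[X in N _ X](gens_inv cox Ss); apply: NtoW_inv.
  by have := gens_conj_neg Ss NsV Uy; rewrite invgK.
have Nn : N (lift s * m * (lift s)^-1) s.
  by rewrite -[X in N _ X](mulgK s s); apply: NtoW_mul (NtoW_inv Ns); apply: NtoW_mul.
apply/(cellP _ Nn).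
exists (lift s * u' * (lift s)^-1), (lift s * u'' * (lift s)^-1).
split; [exact: pos|exact: pos|].
have -> : u = lift s * ((lift s)^-1 * u * lift s) * (lift s)^-1 by gsimp.
by rewrite e; gsimp.
Qed.

(** The element of the root group of [alpha s] met in the middle can be moved
    to the left, since [v] maps [alpha s] to a positive root. *)
Lemma cellMs v s g h : S s -> (len v < len (v * s))%N ->
  cell v g -> cell s h -> cell (v * s) (g * h).
Proof.
move=> Ss lvs /(cellP _ (liftP v))[b [b' [Bb Bb' ->]]].
move=> /(cellP _ (liftP s))[c [c' [Bc Bc' ->]]].
have [u Uu [k [Bk Bk' e]]] := borel_split Ss (liftP s) (borelM Bb' Bc).
apply/(cellP _ (NtoW_mul (liftP v) (liftP s))).
exists (b * (lift v * u * (lift v)^-1)), ((lift s)^-1 * k * lift s * c'); split.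
- apply: borelM => //; apply: Uplus_borel.
  apply: (rootgroup_Uplus _ _ (NtoW_rootgroup (liftP v) (root_simple Ss) Uu)).
    exact/coxeter_root_ltrans/root_simple.
  exact: (simple_root_wlength cox).
- exact: borelM.
- have -> : b * lift v * b' * (c * lift s * c') = b * lift v * (b' * c) * lift s * c'
    by gsimp.
  by rewrite e; gsimp.
Qed.

Lemma cell_ss s g h : S s -> cell s g -> cell s h -> B (g * h) \/ cell s (g * h).
Proof.
move=> Ss /(cellP _ (liftP s))[b [b' [Bb Bb' ->]]].
move=> /(cellP _ (liftP s))[c [c' [Bc Bc' ->]]].
have [u Uu [k [Bk Bk' e]]] := borel_split Ss (liftP s) (borelM Bb' Bc).
have -> : b * lift s * b' * (c * lift s * c') =
    b * ((lift s * u * (lift s)^-1) * ((lift s * lift s) * ((lift s)^-1 * k * lift s * c'))).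
  have -> : b * lift s * b' * (c * lift s * c') = b * lift s * (b' * c) * lift s * c'
    by gsimp.
  by rewrite e; gsimp.
have Bss : B (lift s * lift s).
  by apply/torus_borel/NtoW1; rewrite -(gens_sq cox Ss); apply: NtoW_mul.
have Bz : B (lift s * lift s * ((lift s)^-1 * k * lift s * c')).
  by do 2 apply: borelM => //.
have [u1|u1] := pselect (lift s * u * (lift s)^-1 = 1).
  by left; rewrite u1 mul1g; apply: borelM.
right; apply: cell_borell => //; apply: cell_borelr => //.
by apply: cell_opposite => //; apply: gens_conj_pos.
Qed.

Lemma cellM_gen v s g h : S s -> cell v g -> cell s h ->
  cell (v * s) (g * h) \/ cell v (g * h).
Proof.
move=> Ss cg ch.
have [lt|ge] := ltnP (len v) (len (v * s)); first by left; apply: cellMs.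
have vE : v = (v * s) * s by rewrite -mulgA (gens_sq cox Ss) mulg1.
move: cg; rewrite {1}vE => /cell_split[k [l [ck cl ->]]]; rewrite -mulgA.
have [Blh|clh] := cell_ss Ss cl ch; first by left; apply: cell_borelr.
right; rewrite vE; apply: cellMs => //; rewrite -vE.
by rewrite ltn_neqAle ge andbT; apply/eqP; apply: wlength_mul_neq.
Qed.

(** If [B] contained a lift of [b <> 1], it would conjugate a positive root
    group, hence a subgroup of [Up], to a negative simple one. *)
Lemma cell1_uniq b g : B g -> cell b g -> b = 1.
Proof.
move=> Bg /(cellP _ (liftP b))[c [c' [Bc Bc' e]]].
have Bb : B (lift b).
  have -> : lift b = c^-1 * g * c'^-1 by rewrite e; gsimp.
  by apply: borelM (borelV Bc'); apply: borelM => //; apply: borelV.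
apply: contrapT => b1.
have b1V : b^-1 <> 1 by move=> e1; apply: b1; rewrite -[b]invgK e1 invg1.
have [s Ss] := last_letter cox b1V.
have -> : b^-1 * s = (s * b)^-1 by rewrite invgM (gens_inv cox Ss).
rewrite !(wlengthV cox) => lb.
have [_ [_ _ nUp _]] := rgd; apply: (nUp s Ss) => x Ux.
have rs := coxeter_rootC cox (root_simple Ss).
have := NtoW_rootgroup (NtoW_inv (liftP b)) rs Ux; rewrite invgK => Uy.
have -> : x = lift b * ((lift b)^-1 * x * lift b) * (lift b)^-1 by gsimp.
apply: borel_Uplus => //; apply: (rootgroup_Uplus _ _ Uy).
  exact: coxeter_root_ltrans.
apply/ltransP; rewrite invgK mulg1.
by rewrite /simple_root /= lb ltnNge leqnSn.
Qed.

Lemma cell_uniq (a b : W) g : cell a g -> cell b g -> a = b.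
Proof.
wlog lab : a b / (len a <= len b)%N.
  move=> h; have [le|/ltnW le] := leqP (len a) (len b); first exact: h.
  by move=> ca cb; apply/esym/h.
have [n] := ubnP (len a); elim: n a b g lab => // n IHn a b g lab la ca cb.
have [a1|a1] := pselect (a = 1).
  by rewrite a1; apply/esym/(cell1_uniq _ cb)/cell1P; rewrite -a1.
have [s Ss las] := last_letter cox a1.
have mulss v : v * s * s = v by rewrite -mulgA (gens_sq cox Ss) mulg1.
move: ca; rewrite -{1}(mulss a) => /cell_split[k [l [ck cl e]]].
have clV : cell s l^-1 by rewrite -(gens_inv cox Ss); apply: cellV.
have kE : k = g * l^-1 by rewrite e; gsimp.
have := leq_wlength_mul cox (b * s) Ss; rewrite mulss => lb.
have [] := cellM_gen Ss cb clV; rewrite -kE => ck'.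
  by rewrite -(mulss a) (IHn (a * s) (b * s) k) ?mulss //; lia.
have ab : a * s = b by apply: (IHn _ _ k) => //; lia.
by move: lab las; rewrite -ab; lia.
Qed.

Lemma cellM_add (a b : W) g h : len (a * b) = (len a + len b)%N ->
  cell a g -> cell b h -> cell (a * b) (g * h).
Proof.
have [n] := ubnP (len b); elim: n b h => // n IHn b h lb lab ca cb.
have [b1|b1] := pselect (b = 1).
  by move: cb; rewrite b1 mulg1 => /cell1P Bh; apply: cell_borelr.
have [s Ss lbs] := last_letter cox b1.
have mulss v : v * s * s = v by rewrite -mulgA (gens_sq cox Ss) mulg1.
move: cb; rewrite -{1}(mulss b) => /cell_split[k [l [ck cl ->]]].
have := leq_wlength_mul cox (a * (b * s)) Ss; have := leq_wlengthM cox a (b * s).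
rewrite -[a * (b * s) * s]mulgA mulss lab lbs => l1 l2.
rewrite -{1}(mulss b) !mulgA; apply: cellMs => //; rewrite -mulgA.
  by rewrite -mulgA mulss lab lbs addnS ltnS.
apply: IHn => //; first by rewrite -ltnS -lbs.
by apply/eqP; rewrite eqn_leq l1 -ltnS -addnS.
Qed.

(** The last chambers [p] and [p'] before [k] on the two galleries are
    [s]-adjacent or equal. If they were different, going from [p] to [p'] would
    put [p'] in the cell of [a * b], whereas it is in that of [a * (b * s)]. *)
Lemma cell_mid_uniq (a b : W) g g' k : len (a * b) = (len a + len b)%N ->
  cell a g -> cell b (g^-1 * k) -> cell a g' -> cell b (g'^-1 * k) -> B (g^-1 * g').
Proof.
have [n] := ubnP (len b); elim: n b k => // n IHn b k lb lab cg cgk cg' cgk'.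
have [b1|b1] := pselect (b = 1).
  move: cgk cgk'; rewrite b1 => /cell1P Bk /cell1P/borelV Bk'.
  by have := borelM Bk Bk'; gsimp.
have [s Ss lbs] := last_letter cox b1.
have mulss v : v * s * s = v by rewrite -mulgA (gens_sq cox Ss) mulg1.
have split h : cell b (h^-1 * k) ->
    exists p, cell (b * s) (h^-1 * p) /\ cell s (p^-1 * k).
  rewrite -{1}(mulss b) => /cell_split[p [l [cp cl e]]].
  by exists (h * p); rewrite mulKg invgM -mulgA e mulKg.
have [p [cp cpk]] := split _ cgk; have [p' [cp' cpk']] := split _ cgk'.
have := leq_wlength_mul cox (a * (b * s)) Ss; have := leq_wlengthM cox a (b * s).
rewrite -[a * (b * s) * s]mulgA mulss lab lbs => l1 l2.
have labs : len (a * (b * s)) = (len a + len (b * s))%N.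
  by apply/eqP; rewrite eqn_leq l1 -ltnS -addnS.
have ap : cell (a * (b * s)) p by have := cellM_add labs cg cp; rewrite mulVKg.
have ap' : cell (a * (b * s)) p' by have := cellM_add labs cg' cp'; rewrite mulVKg.
have cpkV : cell s (p'^-1 * k)^-1 by rewrite -(gens_inv cox Ss); apply: cellV.
have := cell_ss Ss cpk cpkV; have -> : p^-1 * k * (p'^-1 * k)^-1 = p^-1 * p' by gsimp.
case=> [Bp|cs].
  apply: (IHn (b * s) p') => //; first by rewrite -ltnS -lbs.
  by have := cell_borelr Bp cp; gsimp.
have lt : (len (a * (b * s)) < len (a * (b * s) * s))%N.
  by rewrite -mulgA mulss lab lbs addnS ltnS.
have := cellMs Ss lt ap cs; rewrite mulVKg => /(cell_uniq ap') e.
by move: lt; rewrite -e ltnn.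
Qed.

Lemma cell_finite v : (forall a, root a -> finite_set (U a)) ->
  exists2 F : set G, finite_set F & forall g, cell v g -> exists2 f, F f & B (f^-1 * g).
Proof.
move=> finU; have [n] := ubnP (len v); elim: n v => // n IHn v lv.
have [v1|v1] := pselect (v = 1).
  exists [set 1]; first exact: finite_set1.
  by move=> g; rewrite v1 => /cell1P Bg; exists 1; gsimp.
have [s Ss lvs] := last_letter cox v1.
have mulss (x : W) : x * s * s = x by rewrite -mulgA (gens_sq cox Ss) mulg1.
have [|F finF FP] := IHn (v * s); first by rewrite -ltnS -lvs.
exists [set f * u * lift s | f in F & u in U (alpha s)].
  by apply: finite_image2 => //; apply/finU/root_simple.
move=> g; rewrite -{1}(mulss v) => /cell_split[h [k [ch ck ->]]].
have [f Ff Bf] := FP _ ch; move: (cell_borell Bf ck).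
move=> /(cellP _ (liftP s))[b [b' [Bb Bb' e]]].
have [u Uu [c [Bc Bc' eb]]] := borel_split Ss (liftP s) Bb.
exists (f * u * lift s); first by exists f => //; exists u.
have -> : (f * u * lift s)^-1 * (h * k) =
    (lift s)^-1 * u^-1 * (f^-1 * h * k) by gsimp.
rewrite e eb; have -> : (lift s)^-1 * u^-1 * (u * c * lift s * b') =
    (lift s)^-1 * c * lift s * b' by gsimp.
exact: borelM.
Qed.

(** * The Weyl distance *)

Local Notation C := (coset_chamber S U).
Local Notation delta := (@weyl_dist W G S U).
Implicit Types (d e p : chamber S U).

Lemma coset_chamberP g h : C g = C h <-> B (g^-1 * h).
Proof.
split=> [/(congr1 (@proj1_sig _ _))/= e|Bgh].
  by apply/ltransP; rewrite e; apply/ltransP; rewrite mulVg; exact: borel1.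
apply: eq_exist; apply/seteqP; split=> x /ltransP Bx; apply/ltransP.
  have -> : h^-1 * x = (g^-1 * h)^-1 * (g^-1 * x) by gsimp.
  by apply: borelM => //; apply: borelV.
by have := borelM Bgh Bx; gsimp.
Qed.

Lemma chamber_coset d : exists g, d = C g.
Proof. by case: d => X [g eX]; exists g; apply: eq_exist. Qed.

Lemma weyl_distE g h v : delta (C g) (C h) v <-> cell v (g^-1 * h).
Proof.
split=> [[g' [h' [n [/coset_chamberP eg /coset_chamberP eh Nn cgh]]]]|[n Nn cgh]].
  have -> : g^-1 * h = (g^-1 * g') * (g'^-1 * h') * (h^-1 * h')^-1 by gsimp.
  apply: cell_borelr; first exact: borelV.
  by apply: cell_borell => //; exists n.
by exists g, h, n.
Qed.

Lemma weyl_dist_sym d e v : delta d e v -> delta e d v^-1.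
Proof.
have [g ->] := chamber_coset d; have [h ->] := chamber_coset e.
by move=> /weyl_distE/cellV cgh; apply/weyl_distE; move: cgh; gsimp.
Qed.

Lemma weyl_dist_add d e p v w : len (v * w) = (len v + len w)%N ->
  delta d e v -> delta e p w -> delta d p (v * w).
Proof.
have [g ->] := chamber_coset d; have [h ->] := chamber_coset e.
have [k ->] := chamber_coset p => lvw /weyl_distE cv /weyl_distE cw.
by apply/weyl_distE; have := cellM_add lvw cv cw; gsimp.
Qed.

Lemma weyl_dist_split d p v w : delta d p (v * w) ->
  exists2 e, delta d e v & delta e p w.
Proof.
have [g ->] := chamber_coset d; have [k ->] := chamber_coset p.
move=> /weyl_distE/cell_split[x [y [cx cy exy]]]; exists (C (g * x)).
  by apply/weyl_distE; rewrite mulKg.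
by apply/weyl_distE; rewrite invgM -mulgA exy mulKg.
Qed.

Lemma weyl_dist_mid_uniq d p e e' v w : len (v * w) = (len v + len w)%N ->
  delta d e v -> delta e p w -> delta d e' v -> delta e' p w -> e = e'.
Proof.
have [g ->] := chamber_coset d; have [k ->] := chamber_coset p.
have [x ->] := chamber_coset e; have [y ->] := chamber_coset e'.
move=> lvw /weyl_distE c1 /weyl_distE c2 /weyl_distE c3 /weyl_distE c4.
apply/coset_chamberP.
have := @cell_mid_uniq v w (g^-1 * x) (g^-1 * y) (g^-1 * k) lvw c1 _ c3.
by gsimp; apply.
Qed.

Lemma sphere_finite d v : (forall a, root a -> finite_set (U a)) ->
  finite_set [set e | delta d e v].
Proof.
move=> finU; have [F finF FP] := cell_finite v finU.
have [g ->] := chamber_coset d.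
apply: (sub_finite_set _ (finite_image (fun f => C (g * f)) finF)) => e /=.
have [h ->] := chamber_coset e => /weyl_distE/FP[f Ff Bf].
by exists f => //; apply/coset_chamberP; move: Bf; gsimp.
Qed.

End BNpair.

(** * Contraction groups and nubs *)
Section Nub.
Context {H : topologicalGroupType}.
Implicit Types (g h p x : H) (A : set H).

Lemma mull_continuous p : continuous (fun x => p * x).
Proof.
move=> x; apply: (@continuous_comp _ _ _ (fun y => (p, y)) (fun z => z.1 * z.2)).
  by apply: cvg_pair; [exact: cvg_cst|exact: cvg_id].
exact: mulg_continuous.
Qed.

Lemma mulr_continuous p : continuous (fun x => x * p).
Proof.
move=> x; apply: (@continuous_comp _ _ _ (fun y => (y, p)) (fun z => z.1 * z.2)).
  by apply: cvg_pair; [exact: cvg_id|exact: cvg_cst].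
exact: mulg_continuous.
Qed.

Lemma conj_continuous p : continuous (fun x => p^-1 * x * p).
Proof.
move=> x; apply: (@continuous_comp _ _ _ (fun y => p^-1 * y) (fun y => y * p)).
  exact: mull_continuous.
exact: mulr_continuous.
Qed.

Lemma con_conj g h p : commute g p -> con g h -> con g (p^-1 * h * p).
Proof.
move=> cgp hg; have cX n : commute (g ^+ n) p.
  by apply/commute_sym/commuteX/commute_sym.
have E : (fun n => g ^+ n * (p^-1 * h * p) * g ^- n) =
    (fun x => p^-1 * x * p) \o (fun n => g ^+ n * h * g ^- n).
  apply/funext => n /=.
  have e1 : p^-1 * g ^+ n = g ^+ n * p^-1 by apply/commute_sym/commuteV.
  have e2 : g ^- n * p = p * g ^- n by apply/commute_sym/commuteV/commute_sym.
  by rewrite !mulgA e1 -!mulgA e2.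
change ((fun n => g ^+ n * (p^-1 * h * p) * g ^- n) @ \oo --> (1 : H)).
by rewrite E; have := cvg_comp _ _ hg (@conj_continuous p 1); rewrite mulg1 mulVg.
Qed.

Lemma closure_con_conj g h p : commute g p ->
  closure (con g) h -> closure (con g) (p^-1 * h * p).
Proof.
move=> cgp hg B /(@conj_continuous p h)/hg[x [gx Bx]].
by exists (p^-1 * x * p); split=> //; apply: con_conj.
Qed.

Lemma nub_conj g h p : commute g p -> nub g h -> nub g (p^-1 * h * p).
Proof.
move=> cgp [hg hgV]; split; apply: closure_con_conj => //.
by apply/commute_sym/commuteV/commute_sym.
Qed.

Lemma commute_zpow g z : commute g (zpow g z).
Proof.
by case: z => n /=; [|apply: commuteV]; apply: commuteX; apply: commute_refl.
Qed.

End Nub.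

(** * The action of a completion on the building *)

Section Fixators.
Context {W G : groupType} {S : set W} {U : set W -> set G}.
Context (cox : coxeter_system S) (rgd : rgd_system S U).
Context (lift : W -> G) (liftP : forall v, NtoW S U (lift v) v).
Context {H : topologicalGroupType} {iota : G -> H}.
Context {act : H -> chamber S U -> chamber S U}.
Context (compl : completion iota act).
Implicit Types (v w a : W) (g k n : G) (h x y : H) (d e : chamber S U).
Local Notation len := (wlength S).
Local Notation B := (borel S U).
Local Notation N := (NtoW S U).
Local Notation C := (coset_chamber S U).
Local Notation cell := (@cell W G S U).
Local Notation delta := (@weyl_dist W G S U).

Lemma act1 d : act 1 d = d.
Proof. by have [_ [a1 _ _] _ _ _] := compl; apply: a1. Qed.

Lemma actM h x d : act (h * x) d = act h (act x d).
Proof. by have [_ [_ aM _] _ _ _] := compl; apply: aM. Qed.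

Lemma act_delta h d e v : delta (act h d) (act h e) v <-> delta d e v.
Proof. by have [_ [_ _ aD] _ _ _] := compl; apply: aD. Qed.

Lemma actK h d : act h^-1 (act h d) = d.
Proof. by rewrite -actM mulVg act1. Qed.

Lemma actVK h d : act h (act h^-1 d) = d.
Proof. by rewrite -actM mulgV act1. Qed.

Lemma act_iota g k : act (iota g) (C k) = C (g * k).
Proof. by have [_ _ _ _ ->] := compl. Qed.

Lemma iotaM g k : iota (g * k) = iota g * iota k.
Proof. by have [_ _ _ [_ iM] _] := compl; apply: iM. Qed.

Lemma iota1 : iota 1 = 1.
Proof. by apply: (mulgI (iota 1)); rewrite -iotaM !mulg1. Qed.

Lemma iotaV g : iota g^-1 = (iota g)^-1.
Proof. by apply/esym/mulg1_eq; rewrite -iotaM mulgV iota1. Qed.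

Lemma iotaX g i : iota (g ^+ i) = iota g ^+ i.
Proof. by elim: i => [|i IHi]; rewrite ?iota1 // !expgS iotaM IHi. Qed.

Lemma near_act h d : \forall x \near h, act x d = act h d.
Proof.
have [_ _ ac _ _] := compl; have := ac h [set d] (finite_set1 d).
by apply: filterS => x /(_ d erefl).
Qed.

(** The conjugate [g ^+ i * h * g ^- i] is eventually close enough to [1] to
    fix [d]. *)
Lemma con_fixes (g h : H) d : con g h ->
  exists i0, forall i, (i0 <= i)%N -> act h (act (g ^- i) d) = act (g ^- i) d.
Proof.
move=> /(_ _ (near_act 1 d)) [i0 _ hi0]; exists i0 => i /hi0 /=.
rewrite act1 !actM => e.
by rewrite -{2}e -(actM (g ^- i) (g ^+ i)) mulVg act1.
Qed.

Lemma closure_con_act (g h : H) d : closure (con g) h ->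
  exists2 x, con g x & act x d = act h d.
Proof. by move=> /(_ _ (near_act h d))[x [gx xd]]; exists x. Qed.

Lemma cellX a k i : additive_powers S a -> cell a k -> cell (a ^+ i) (k ^+ i).
Proof.
move=> aadd ck; elim: i => [|i IHi].
  exact/cell1P/borel1.
by rewrite !expgSr; apply: (cellM_add cox rgd liftP) => //; rewrite -expgSr -addn1 aadd.
Qed.

(** The chamber lies on a bi-infinite geodesic stabilised by a power of [g].
    An element of the nub agrees at this chamber with one that fixes the
    geodesic far away in one direction and with one that fixes it far away in
    the other, so it maps the chamber to one lying between the same two points
    at the same Weyl distances. *)
Lemma nub_fixes_geodesic g k a q h : (0 < q)%N -> additive_powers S a ->
  cell a (k^-1 * g ^+ q * k) -> nub (iota g) h -> act h (C k) = C k.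
Proof.
move=> q0 aadd ck [hg hgV].
have [x gx xh] := closure_con_act (C k) hg.
have [y gy yh] := closure_con_act (C k) hgV.
have [i0 xi] := con_fixes (C k) gx; have [j0 yj] := con_fixes (C k) gy.
pose m := (i0 + j0)%N.
pose p := C (g ^- (q * m) * k); pose p' := C (g ^+ (q * m) * k).
have xp : act x p = p.
  have := xi (q * m)%N; rewrite -iotaX -iotaV act_iota; apply.
  by rewrite /m; nia.
have yp : act y p' = p'.
  have := yj (q * m)%N; rewrite expVgn invgK -iotaX act_iota; apply.
  by rewrite /m; nia.
have ckm : cell (a ^+ m) (k^-1 * g ^+ (q * m) * k).
  have := cellX m aadd ck; have := conjXg (g ^+ q) k m.
  by rewrite !conjgE !mulgA -expgnA => ->.
have d1 : delta p (C k) (a ^+ m) by apply/(weyl_distE liftP); move: ckm; gsimp.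
have d2 : delta (C k) p' (a ^+ m) by apply/(weyl_distE liftP); move: ckm; gsimp.
have lm : len (a ^+ m * a ^+ m) = (len (a ^+ m) + len (a ^+ m))%N.
  by rewrite -expgnDr aadd.
apply/esym/(weyl_dist_mid_uniq cox rgd liftP lm d1 d2).
  by rewrite -xh -{1}xp; apply/act_delta.
by rewrite -yh -{1}yp; apply/act_delta.
Qed.

Section Admissible.
Context {V : set H} (adm : admissible iota act V).

Lemma admissible_subgroup : is_subgroup V.
Proof. by have [[]] := adm. Qed.

Lemma admissible_open : open V.
Proof. by have [[_ []]] := adm. Qed.

Lemma admissible_base x : V x -> act x (C 1) = C 1.
Proof. by have [_ _ VF _ _] := adm; move=> /VF; apply. Qed.

(** Along a reduced word [s1 ... sn] of [v], split off from [x] its component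
    in the root group of [s1]. That component fixes the second chamber of the
    gallery from [C 1] to [C n], as [x] does, so it is trivial. *)
Lemma admissible_conj v n x : N n v -> V x -> act x (C n) = C n ->
  V ((iota n)^-1 * x * iota n).
Proof.
have [m] := ubnP (len v); elim: m v n x => // m IHm v n x lv Nn Vx xn.
have [_ VM _] := admissible_subgroup; have [_ _ _ VT Vs] := adm.
have [v1|v1] := pselect (v = 1).
  by apply/conjsP; rewrite VT //; apply: NtoW1; rewrite -v1.
have v1V : v^-1 <> 1 by move=> e; apply: v1; rewrite -[v]invgK e invg1.
have [s Ss] := last_letter cox v1V.
have -> : v^-1 * s = (s * v)^-1 by rewrite invgM (gens_inv cox Ss).
rewrite !(wlengthV cox) => lsv.
have vE : s * (s * v) = v by rewrite mulgA (gens_sq cox Ss) mul1g.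
have Ns := liftP s; set r := lift s in Ns.
have NsV : N r^-1 s by rewrite -[X in N _ X](gens_inv cox Ss); apply: NtoW_inv.
have Nn' : N (r^-1 * n) (s * v) by apply: NtoW_mul.
have [_ _ VE _ _] := Vs s r Ss Ns.
move: (Vx); rewrite {1}VE => -[_ [u Uu <-] [y [Vy /conjsP yr] exy]].
have ls := wlength_gen cox Ss.
have lsum : len (s * (s * v)) = (len s + len (s * v))%N by rewrite vE ls.
have ds : delta (C 1) (C r) s.
  by apply/(weyl_distE liftP); rewrite invg1 mul1g; apply: NtoW_cell.
have dn : delta (C r) (C n) (s * v) by apply/(weyl_distE liftP); apply: NtoW_cell.
have x1 := admissible_base Vx.
have xr : act x (C r) = C r.
  apply/esym/(weyl_dist_mid_uniq cox rgd liftP lsum ds dn).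
    by rewrite -{1}x1; apply/act_delta.
  by rewrite -{1}xn; apply/act_delta.
have yr' : act y (C r) = C r.
  have := admissible_base yr; rewrite !actM -(iotaV r) !act_iota mulg1.
  by move/(congr1 (act (iota r))); rewrite iotaV actVK act_iota mulg1.
have ur : act (iota u) (C r) = C r by rewrite -{1}yr' -actM exy.
have u1 : u = 1.
  apply: contrapT => u1.
  have Uneg : U (~` simple_root S s) (r^-1 * u * r).
    by have := gens_conj_pos cox Ss NsV Uu; rewrite invgK.
  have : cell s (r^-1 * u * r).
    apply: (cell_opposite cox rgd liftP Ss Uneg) => e; apply: u1.
    by have := congr1 (fun z => r * z * r^-1) e; gsimp.
  move: ur; rewrite act_iota => /esym/coset_chamberP; rewrite mulgA => Bu.
  by move=> /(cell1_uniq cox rgd liftP Bu) s1; move: ls; rewrite s1 (wlength1 cox).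
have xy : x = y by rewrite -exy u1 iota1 mul1g.
have := IHm (s * v) (r^-1 * n) ((iota r)^-1 * x * iota r) _ Nn'.
rewrite !iotaM !iotaV; gsimp; apply.
- by rewrite -ltnS -lsv.
- by rewrite xy.
- by rewrite !actM -!iotaV !act_iota mulVKg xn act_iota.
Qed.

(** Close to [h] there is [x] in [con (iota g)], which some [g ^+ i] conjugates
    into [V], to an element fixing [C (g ^+ i)] when [h] fixes [C 1]. *)
Lemma nub_admissible g v h : N g v -> nub (iota g) h -> act h (C 1) = C 1 -> V h.
Proof.
move=> Ng [hg _] h1; have [V1 VM VV] := admissible_subgroup.
have nV y : V y -> nbhs y V.
  by move=> Vy; apply: open_nbhs_nbhs; split=> //; apply: admissible_open.
have hV : nbhs h [set x | V (h^-1 * x)].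
  by apply: (@mull_continuous _ h^-1 h); apply: nV; rewrite mulVg.
have [x [gx /= Vhx]] := hg _ hV.
have [i _ /(_ i (leqnn i)) /= Vi] := gx _ (nV _ V1).
have x1 : act x (C 1) = C 1.
  by rewrite -[x](mulVKg h) actM (admissible_base Vhx).
have NgX : N (g ^+ i) (v ^+ i).
  elim: i {Vi} => [|i IHi]; first exact/NtoW_torus/torus1.
  by rewrite !expgS; apply: NtoW_mul.
have := admissible_conj NgX Vi; rewrite iotaX; gsimp => Vx.
have -> : h = x * (h^-1 * x)^-1 by gsimp.
apply: VM; last exact: VV.
apply: Vx; rewrite !actM -iotaX -iotaV !act_iota mulVg x1.
by rewrite act_iota mulg1.
Qed.

End Admissible.

Section Residues.
Context (finU : forall r : set W, coxeter_root S r -> finite_set (U r)).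
Local Notation tr g := (act (iota g)).

Lemma tr_delta g d e v : delta (tr g d) (tr g e) v <-> delta d e v.
Proof. exact: act_delta. Qed.

(** Under the hypotheses of [sphere_periodic], [e] is the projection of
    [g ^- i d] to a residue containing [C 1] and [d], and this relation is the
    graph of a permutation of the sphere of radius [v] around [C 1]. *)
Definition sphere_shift g t v i d e :=
  delta (tr (g ^- i) d) e (t ^+ i) /\ delta (C 1) e v.

(** The relations [sphere_shift g t v i] compose as the powers of a permutation
    of a finite set do, so two of them take the same value at [d], and then one
    of them, with [i > 0], fixes [d]. *)
Lemma sphere_periodic g t v d : N g t -> additive_powers S t -> commute t v ->
  (forall i, len (t ^+ i * v) = (len (t ^+ i) + len v)%N) ->
  (forall i, len (t ^+ i * v^-1) = (len (t ^+ i) + len v^-1)%N) ->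
  delta (C 1) d v -> exists2 m, (0 < m)%N & delta (tr (g ^- m) d) d (t ^+ m).
Proof.
move=> Ng tadd ctv lv lvV d0.
have cX i : commute (t ^+ i) v by apply/commute_sym/commuteX/commute_sym.
have cXV i : t ^+ i * v^-1 = v^-1 * t ^+ i by apply/commuteV/cX.
have NgX i : N (g ^+ i) (t ^+ i).
  elim: i => [|i IHi]; first exact/NtoW_torus/torus1.
  by rewrite !expgS; apply: NtoW_mul.
have total i e : delta (C 1) e v -> exists f, sphere_shift g t v i e f.
  move=> ev; have e1 : delta (tr (g ^- i) e) (tr (g ^- i) (C 1)) v^-1.
    by apply/tr_delta; apply: (weyl_dist_sym liftP).
  have e2 : delta (tr (g ^- i) (C 1)) (C 1) (t ^+ i).
    rewrite act_iota mulg1; apply/(weyl_distE liftP); rewrite invgK mulg1.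
    exact: NtoW_cell.
  have lVt : len (v^-1 * t ^+ i) = (len v^-1 + len (t ^+ i))%N.
    by rewrite -cXV lvV addnC.
  have := weyl_dist_add cox rgd liftP lVt e1 e2; rewrite -cXV.
  move=> /(weyl_dist_split liftP)[f f1 f2]; exists f; split=> //.
  by rewrite -[v]invgK; apply: (weyl_dist_sym liftP).
have functional i e f f' : sphere_shift g t v i e f -> sphere_shift g t v i e f' -> f = f'.
  move=> [ef f1] [ef' f1'].
  exact: (weyl_dist_mid_uniq cox rgd liftP (lvV i) ef (weyl_dist_sym liftP f1)
    ef' (weyl_dist_sym liftP f1')).
have injective i e e' f : delta (C 1) e v -> delta (C 1) e' v ->
    sphere_shift g t v i e f -> sphere_shift g t v i e' f -> e = e'.
  move=> e1 e1' [ef _] [ef' _].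
  suff eqtr : tr (g ^- i) e = tr (g ^- i) e'.
    by rewrite -[e](actK (iota (g ^- i))) eqtr actK.
  have lVV : len ((t ^+ i)^-1 * v^-1) = (len (t ^+ i)^-1 + len v^-1)%N.
    by rewrite -invgM !(wlengthV cox) -cX lv.
  have base b : delta (C 1) b v ->
      delta (tr (g ^- i) b) (tr (g ^- i) (C 1)) v^-1.
    by move=> b1; apply/tr_delta; apply: (weyl_dist_sym liftP).
  exact: (weyl_dist_mid_uniq cox rgd liftP lVV (weyl_dist_sym liftP ef)
    (base _ e1) (weyl_dist_sym liftP ef') (base _ e1')).
have comp i j e f f' : sphere_shift g t v i e f -> sphere_shift g t v j f f' ->
    sphere_shift g t v (i + j) e f'.
  move=> [ef _] [ff' f1']; split=> //.
  rewrite !expgnDr invgM iotaM actM.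
  apply: (weyl_dist_add cox rgd liftP _ _ ff'); first by rewrite -expgnDr tadd.
  exact/tr_delta.
have [z zP] := choice (fun i => total i d d0).
have [i [j [ij zij]]] := finite_set_repeat (sphere_finite cox rgd liftP (C 1) v finU)
  (fun i => (zP i).2).
exists (j - i)%N; first by rewrite subn_gt0.
have [d' dd'] := total (j - i)%N d d0; have [f d'f] := total i d' dd'.2.
have := comp _ _ _ _ _ dd' d'f; rewrite subnK 1?ltnW // => df.
move: d'f; rewrite (functional _ _ _ _ df (zP j)) -zij => d'f.
by have := dd'.1; rewrite (injective _ _ _ _ dd'.2 d0 d'f (zP i)).
Qed.

End Residues.
End Fixators.

(** * The nub of a straight standard element *)

Unset Implicit Arguments.

Theorem theorem5p6
  (W : groupType) (S : set W)
  (G : groupType) (U : set W -> set G)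
  (H : topologicalGroupType) (iota : G -> H)
  (act : H -> chamber S U -> chamber S U)
  (V : set H) (sec : W -> G) (w : W) (J : set W) :
  coxeter_system S -> finite_set S ->
  rgd_system S U ->
  (forall a, coxeter_root S a -> finite_set (U a)) ->
  completion iota act ->
  (forall d, compact (Fix act [set d]) /\ open (Fix act [set d])) ->
  admissible iota act V ->
  (forall v, NtoW S U (sec v) v) ->
  straight S w -> standard S w -> is_supp S w J ->
  nub (iota (sec w)) `<=`
    (\bigcap_(z in [set: int]) conjs (zpow (iota (sec w)) z) V)
    `&` Fix act (residue (Jperp S J `|` Jsph J w) (base_chamber S U))
    `&` Fix act (apartment S U `&` residue (Jaff J) (base_chamber S U)).
Proof.
move=> cox _ rgd finU compl _ adm liftP sw _ [[JS Jw] _] h hnub.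
have wadd := straight_additive sw.
set g := sec w; have Ng : NtoW S U g w := liftP w.
have NgX i : NtoW S U (g ^+ i) (w ^+ i).
  elim: i => [|i IHi]; first exact/NtoW_torus/torus1.
  by rewrite !expgS; apply: NtoW_mul.
have fixes := nub_fixes_geodesic cox rgd liftP compl.
split; first split.
- move=> z _; apply/conjsP.
  have znub := nub_conj (commute_zpow (iota g) z) hnub.
  apply: (nub_admissible cox rgd liftP compl adm Ng znub).
  apply: (fixes g 1 w 1%N) znub => //.
  by rewrite invg1 mul1g mulg1; apply: NtoW_cell.
- move=> y [v Kv yv].
  have [p [p0 cpv lpv]] := residue_power cox JS Jw sw Kv.
  have [m m0] := sphere_periodic cox rgd liftP compl finU (NgX p) (additive_powersX p wadd)
    cpv (fun i => (lpv i).1) (fun i => (lpv i).2) yv.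
  have [k ->] := chamber_coset y.
  rewrite (act_iota compl) => /(weyl_distE liftP); rewrite invgM invgK -!expgnA => c.
  apply: (fixes g k _ (p * m)%N) c hnub; first by rewrite muln_gt0 p0.
  exact: additive_powersX.
- move=> _ [[n [v [Nn ->]]] [v' Lv' /(weyl_distE liftP)]].
  rewrite invg1 mul1g => cv'.
  have {cv'} ev : v = v' by apply: (cell_uniq cox rgd liftP) cv'; apply: NtoW_cell.
  rewrite -ev in Lv'.
  have [m m0 madd] := affine_conjugate_additive cox JS Jw sw Lv'.
  apply: (fixes g n _ m) madd _ hnub => //.
  exact: NtoW_cell (NtoW_mul (NtoW_mul (NtoW_inv Nn) (NgX m)) Nn).
Qed.
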